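(* For an alphabet $\Sigma=\{\sigma_1,\dots,\sigma_k\}$ of size $k\ge 2$, let $R_k(z)=\sum_{\alpha\in\mathrm{RE}_{na}} z^{|\alpha|}$ and $L_k(z)=\sum_{\alpha\in\mathrm{RE}_{na}} |\alpha|_\Sigma\, z^{|\alpha|}$, where $|\alpha|_\Sigma$ is the number of letter occurrences in $\alpha$. Then for each $k$ the limit $\ell_k:=\lim_{n\to\infty}\frac{[z^n]L_k(z)}{n\,[z^n]R_k(z)}$ (the asymptotic ratio of letters in expressions of $\mathrm{RE}_{na}$) exists, and $\lim_{k\to\infty}\ell_k=\frac12$.
   Context: Regular expressions over $\Sigma$ are generated by $\beta := \varepsilon \mid \sigma\ (\sigma\in\Sigma) \mid (\beta+\beta) \mid (\beta\cdot\beta) \mid (\beta^\star)$ (the empty-set expression is not counted). The size $|\beta|$ is the number of occurrences of the symbols $\varepsilon$, letters, $+$, $\cdot$, $\star$ in $\beta$ (parentheses not counted). A $\Sigma$-star expression is an expression $(\tau^\star)$ where $\tau$ is a fully parenthesized union of the $k$ letters, each occurring exactly once, in any order and any bracketing. $\mathrm{RE}_{na}$ (''regular expressions without $\Sigma^\star$ in unions'') is the set of regular expressions having no subexpression $(\beta_1+\beta_2)$ in which $\beta_1$ or $\beta_2$ is a $\Sigma$-star expression. $[z^n]F(z)$ denotes the coefficient of $z^n$. *)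

(* Defs.v *)
From mathcomp Require Import all_boot.
From Stdlib Require Import Reals.

Set Implicit Arguments.
Unset Strict Implicit.
Unset Printing Implicit Defensive.

Inductive rexp (k : nat) : Type :=
| Eps : rexp k
| Sym : 'I_k -> rexp k
| Plus : rexp k -> rexp k -> rexp k
| Cat : rexp k -> rexp k -> rexp k
| Star : rexp k -> rexp k.

Arguments Eps {k}.

Fixpoint rsize k (e : rexp k) : nat :=
  match e with
  | Eps => 1
  | Sym _ => 1
  | Plus a b => (rsize a + rsize b).+1
  | Cat a b => (rsize a + rsize b).+1
  | Star a => (rsize a).+1
  end.

Fixpoint nletters k (e : rexp k) : nat :=
  match e with
  | Eps => 0
  | Sym _ => 1
  | Plus a b => nletters a + nletters b
  | Cat a b => nletters a + nletters b
  | Star a => nletters a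
  end.

Fixpoint union_letters k (t : rexp k) : option (seq 'I_k) :=
  match t with
  | Sym a => Some [:: a]
  | Plus a b =>
      match union_letters a, union_letters b with
      | Some s, Some s' => Some (s ++ s')
      | _, _ => None
      end
  | _ => None
  end.

Definition sigma_star k (e : rexp k) : bool :=
  match e with
  | Star t =>
      match union_letters t with
      | Some s => perm_eq s (enum 'I_k)
      | None => false
      end
  | _ => false
  end.

Fixpoint re_na k (e : rexp k) : bool :=
  match e with
  | Eps => true
  | Sym _ => true
  | Plus a b => [&& ~~ sigma_star a, ~~ sigma_star b, re_na a & re_na b]
  | Cat a b => re_na a && re_na b
  | Star a => re_na a
  end.

(* Enumeration of all expressions by size: exprs_upto k n = [:: E_0; ...; E_n],
   where E_m lists every expression of size exactly m, once. *)
Fixpoint exprs_upto k (n : nat) : seq (seq (rexp k)) :=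
  match n with
  | 0 => [:: [::]]
  | n'.+1 =>
      let L := exprs_upto k n' in
      let E i := nth [::] L i in
      let lvl :=
        (if n' == 0 then Eps :: map (@Sym k) (enum 'I_k) else [::])
        ++ map (@Star k) (E n')
        ++ flatten [seq [seq Plus a b | a <- E i, b <- E (n' - i)]
                        ++ [seq Cat a b | a <- E i, b <- E (n' - i)]
                   | i <- iota 1 n'.-1]
      in rcons L lvl
  end.

Definition exprs k (n : nat) : seq (rexp k) := nth [::] (exprs_upto k n) n.

Definition coefR k (n : nat) : nat := count (@re_na k) (exprs k n).

Definition coefL k (n : nat) : nat :=
  sumn [seq nletters e | e <- exprs k n & re_na e].

Definition letter_ratio (k n : nat) : R :=
  (INR (coefL k n) / (INR n * INR (coefR k n)))%R.

(* Main.v *)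
Require Import Defs.
From HB Require Import structures.
From mathcomp Require Import all_boot all_order all_algebra.
From mathcomp Require Import boolp complex polyrcf.
From mathcomp Require Import ring lra zify.

(** Let [R], [L] and [S] be the generating functions of the expressions in RE_na, of
their letters, and of the Sigma-star expressions; [S] is a monomial [s X^(2k)].
Splitting an expression at its root gives
[R = (k+1)X + XR + XR^2 + X(R-S)^2] and [L = kX + XL + 2XLR + 2X(R-S)(L-kS)].
Put [h = X + 4XR - 2XS], which has nonnegative coefficients. The first equation says
that [(1-h)^2] is a polynomial [Delta], and with [U = 1/(1-h)] and [theta = X d/dX] the
second one becomes [L = A U + polynomial], while [theta h = P U], with [A] and
[P = -X Delta'/2] polynomials. Hence all coefficients involved are asymptotically
multiples of those of [U], and no singularity analysis is needed: it is enough to show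
that [U_n / U_(n+1)] tends to the least positive root [rho] of [Delta].

As [h] has positive coefficients, [rho] is a simple root and the only complex root of
modulus at most [rho]. So the coefficients of [Q = - theta Delta / Delta], which are the
power sums of the inverses of the roots, are [rho^(-n)] up to an exponentially smaller
error. Since [2 theta U = Q U], this yields
[U_(n+1) / U_n = rho^(-1) + O(1/n)], where the error terms are controlled by the
supermultiplicativity of the renewal sequence [U].

The limit of the ratio is [4 rho A(rho) / P(rho)]. There are at most [(4k)^k / 2]
Sigma-star expressions and [8(k+1) rho^2 <= 1], so [S(rho) <= 2^(-k)/2]; together with
[Delta(rho) = 0] this forces [8 k rho^2] to tend to [1] and the ratio to [1/2]. *)

Set Implicit Arguments.
Unset Strict Implicit.
Unset Printing Implicit Defensive.

Import Order.TTheory GRing.Theory Num.Theory.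
Local Open Scope ring_scope.

(** * Formal power series *)

Record fps (R : Type) := Fps { fps_coef :> nat -> R }.

Lemma fpsP (R : Type) (f g : fps R) : f =1 g -> f = g.
Proof. by case: f g => [f] [g] /funext /= ->. Qed.

HB.instance Definition _ (R : Type) := gen_eqMixin (fps R).
HB.instance Definition _ (R : Type) := gen_choiceMixin (fps R).

Section FormalPowerSeries.
Variable R : comNzRingType.
Implicit Types f g h : fps R.

Definition fps_add f g : fps R := Fps (fun n => f n + g n).
Definition fps_opp f : fps R := Fps (fun n => - f n).
Definition fps_mul f g : fps R := Fps (fun n => \sum_(i < n.+1) f i * g (n - i)%N).
Definition fps_poly (p : {poly R}) : fps R := Fps (fun n => p`_n).

Lemma fps_addA : associative fps_add.
Proof. by move=> f g h; apply/fpsP => n; rewrite /= addrA. Qed.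

Lemma fps_addC : commutative fps_add.
Proof. by move=> f g; apply/fpsP => n; rewrite /= addrC. Qed.

Lemma fps_add0 : left_id (fps_poly 0) fps_add.
Proof. by move=> f; apply/fpsP => n; rewrite /= coef0 add0r. Qed.

Lemma fps_addN : left_inverse (fps_poly 0) fps_opp fps_add.
Proof.
by move=> f; apply/fpsP => n; rewrite /= coef0 addNr.
Qed.

HB.instance Definition _ := GRing.isZmodule.Build (fps R)
  fps_addA fps_addC fps_add0 fps_addN.

Definition fps_trunc f N : {poly R} := \poly_(i < N) f i.

(** A coefficient of a product involves only lower coefficients, so it can be read off a product of
    polynomials; commutativity and associativity are inherited from [{poly R}] this way. *)
Lemma fps_mul_trunc f g n N : (n < N)%N ->
  fps_mul f g n = (fps_trunc f N * fps_trunc g N)`_n.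
Proof.
move=> nN; rewrite /= coefM; apply: eq_bigr => -[i /= i_n] _.
by rewrite !coef_poly (leq_trans i_n nN) (leq_ltn_trans (leq_subr _ _) nN).
Qed.

Lemma fps_mulC : commutative fps_mul.
Proof.
by move=> f g; apply/fpsP => n; rewrite !(fps_mul_trunc _ _ (ltnSn n)) mulrC.
Qed.

Lemma fps_mulA : associative fps_mul.
Proof.
move=> f g h; apply/fpsP => n.
have assoc f1 f2 f3 : fps_mul f1 (fps_mul f2 f3) n =
    (fps_trunc f1 n.+1 * (fps_trunc f2 n.+1 * fps_trunc f3 n.+1))`_n.
  rewrite coefM; apply: eq_bigr => i _.
  by rewrite coef_poly ltn_ord (@fps_mul_trunc f2 f3 _ n.+1) // ltnS leq_subr.
by rewrite assoc fps_mulC assoc mulrA mulrC mulrA.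
Qed.

Lemma fps_mul1 : left_id (fps_poly 1) fps_mul.
Proof.
move=> f; apply/fpsP => n; rewrite /= big_ord_recl coef1 mul1r.
by rewrite subn0 big1 ?addr0 // => i _; rewrite coef1 mul0r.
Qed.

Lemma fps_mulDl : left_distributive fps_mul fps_add.
Proof.
move=> f g h; apply/fpsP => n; rewrite /= -big_split.
by apply: eq_bigr => i _; rewrite mulrDl.
Qed.

Lemma fps_one_neq0 : fps_poly 1 != 0.
Proof.
apply/eqP => /(congr1 (fun f : fps R => f 0%N)).
by rewrite /= coef1 [RHS]coef0 => /eqP; rewrite oner_eq0.
Qed.

HB.instance Definition _ := GRing.Zmodule_isComNzRing.Build (fps R)
  fps_mulA fps_mulC fps_mul1 fps_mulDl fps_one_neq0.

Lemma fps0E n : (0 : fps R) n = 0. Proof. exact: coef0. Qed.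
Lemma fps1E n : (1 : fps R) n = (n == 0%N)%:R. Proof. exact: coef1. Qed.
Lemma fpsDE f g n : (f + g) n = f n + g n. Proof. by []. Qed.
Lemma fpsNE f n : (- f) n = - f n. Proof. by []. Qed.
Lemma fpsBE f g n : (f - g) n = f n - g n. Proof. by []. Qed.
Lemma fpsME f g n : (f * g) n = \sum_(i < n.+1) f i * g (n - i)%N.
Proof. by []. Qed.

Lemma fpsME0 f g : (f * g) 0%N = f 0%N * g 0%N.
Proof. by rewrite fpsME big_ord1. Qed.

Lemma fpsMnE f m n : (f *+ m) n = f n *+ m.
Proof. by elim: m => [|m IH]; rewrite ?fps0E // !mulrS fpsDE IH. Qed.

Lemma fps_sumE (I : Type) (r : seq I) (F : I -> fps R) n :
  (\sum_(i <- r) F i) n = \sum_(i <- r) F i n.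
Proof. by elim: r => [|i r IH]; rewrite ?big_nil ?fps0E // !big_cons fpsDE IH. Qed.

Lemma fps_poly_additive : additive fps_poly.
Proof. by move=> p q; apply/fpsP => n; rewrite fpsBE /= coefB. Qed.

Lemma fps_poly_multiplicative : multiplicative fps_poly.
Proof. by split=> [p q|//]; apply/fpsP => n; rewrite fpsME /= coefM. Qed.

HB.instance Definition _ :=
  GRing.isAdditive.Build {poly R} (fps R) fps_poly fps_poly_additive.
HB.instance Definition _ :=
  GRing.isMultiplicative.Build {poly R} (fps R) fps_poly fps_poly_multiplicative.

Lemma fps_polyXM f n : (fps_poly 'X * f) n.+1 = f n.
Proof.
rewrite fpsME big_ord_recl /= coefX mul0r add0r big_ord_recl coefX mul1r.
by rewrite subSS subn0 big1 ?addr0 // => i _; rewrite coefX mul0r.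
Qed.

Lemma fps_polyXM0 f : (fps_poly 'X * f) 0%N = 0.
Proof. by rewrite fpsME0 /= coefX mul0r. Qed.

Lemma fps_polyCM c f n : (fps_poly c%:P * f) n = c * f n.
Proof.
rewrite fpsME big_ord_recl /= coefC subn0 big1 ?addr0 // => i _.
by rewrite coefC mul0r.
Qed.

Definition fps_theta f : fps R := Fps (fun n => f n *+ n).

Lemma fps_thetaD f g : fps_theta (f + g) = fps_theta f + fps_theta g.
Proof. by apply/fpsP => n; rewrite /= mulrnDl. Qed.

Lemma fps_thetaN f : fps_theta (- f) = - fps_theta f.
Proof. by apply/fpsP => n; rewrite /= mulNrn. Qed.

Lemma fps_thetaM f g : fps_theta (f * g) = fps_theta f * g + f * fps_theta g.
Proof.
apply/fpsP => n; rewrite fpsDE /= -big_split -sumrMnl.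
apply: eq_bigr => -[i /= i_n] _.
by rewrite mulrnAl mulrnAr -mulrnDr subnKC.
Qed.

Lemma fps_theta1 : fps_theta 1 = 0.
Proof. by apply/fpsP => -[|n]; rewrite /= coef1 coef0 ?mul0rn. Qed.

Lemma fps_theta_poly p : fps_theta (fps_poly p) = fps_poly ('X * p^`()).
Proof.
by apply/fpsP => -[|n]; rewrite /= coefXM //= coef_deriv.
Qed.

Lemma fps_exp_val f m n : f 0%N = 0 -> (n < m)%N -> (f ^+ m) n = 0.
Proof.
move=> f0; elim: m n => // m IH n nm; rewrite exprS fpsME big1 // => -[[|i] /= i_n] _.
  by rewrite f0 mul0r.
by rewrite IH ?mulr0 //; move: i_n nm; lia.
Qed.

(** The geometric series of [1 - f]. Cutting the sum at [n] is exact when [f] has constant term 1,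
    since then the powers [(1 - f)^m] with [m > n] have no term of degree [n]. *)
Definition fps_inv f : fps R := Fps (fun n => \sum_(m < n.+1) ((1 - f) ^+ m) n).

Lemma fps_mulV f : f 0%N = 1 -> f * fps_inv f = 1.
Proof.
move=> f0; set g := 1 - f; have g0 : g 0%N = 0 by rewrite fpsBE f0 fps1E subrr.
have invE n N : (n <= N)%N -> fps_inv f n = (\sum_(m < N.+1) g ^+ m) n.
  move=> nN; rewrite fps_sumE /=.
  rewrite (big_ord_widen_cond N.+1 xpredT (fun m => (g ^+ m) n)) //.
  rewrite big_mkcond; apply: eq_bigr => m _ /=; case: ltnP => // nm.
  by rewrite fps_exp_val.
apply/fpsP => n.
have -> : (f * fps_inv f) n = (f * \sum_(m < n.+1) g ^+ m) n.
  rewrite !fpsME; apply: eq_bigr => i _.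
  by rewrite (invE _ n) // leq_subr.
have -> : f = - (g - 1) by rewrite /g; ring.
by rewrite mulNr -subrX1 opprB fpsBE fps_exp_val // subr0.
Qed.

Lemma fps_mulI f : f 0%N = 1 -> injective ( *%R f).
Proof.
move=> f0 g h fgh; rewrite -[g]mul1r -[h]mul1r -(fps_mulV f0).
by rewrite mulrAC fgh mulrAC.
Qed.

End FormalPowerSeries.

(** * Change of the coefficient ring *)

Section MapFps.
Variables (R S : comNzRingType) (phi : {rmorphism R -> S}).

Definition map_fps (f : fps R) : fps S := Fps (fun n => phi (f n)).

Lemma map_fps_additive : additive map_fps.
Proof. by move=> f g; apply/fpsP => n; rewrite /= rmorphB. Qed.

Lemma map_fps_multiplicative : multiplicative map_fps.
Proof.
split=> [f g|]; apply/fpsP => n.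
  rewrite /= rmorph_sum.
  by apply: eq_bigr => i _; rewrite rmorphM.
by rewrite /= !coef1 rmorph_nat.
Qed.

HB.instance Definition _ :=
  GRing.isAdditive.Build (fps R) (fps S) map_fps map_fps_additive.
HB.instance Definition _ :=
  GRing.isMultiplicative.Build (fps R) (fps S) map_fps map_fps_multiplicative.

Lemma map_fps_poly p : map_fps (fps_poly p) = fps_poly (map_poly phi p).
Proof. by apply/fpsP => n; rewrite /= coef_map. Qed.

Lemma map_fps_theta f : map_fps (fps_theta f) = fps_theta (map_fps f).
Proof. by apply/fpsP => n; rewrite /= rmorphMn. Qed.

End MapFps.

(** * The dominant root *)

Lemma horner_coef_ge0 (R : numDomainType) (p : {poly R}) x :
  (forall n, 0 <= p`_n) -> 0 <= x -> 0 <= p.[x].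
Proof.
move=> p_ge0 x_ge0; rewrite horner_coef.
by apply: sumr_ge0 => i _; rewrite mulr_ge0 ?exprn_ge0.
Qed.

Lemma ler_normc_horner (R : rcfType) (p : {poly R}) (z : R[i]) x :
  (forall n, 0 <= p`_n) -> `|z| <= x%:C%C ->
  `|(map_poly (real_complex R) p).[z]| <= (p.[x])%:C%C.
Proof.
move=> p_ge0 zx; rewrite !horner_coef size_map_poly rmorph_sum /=.
apply: le_trans (ler_norm_sum _ _ _) _; apply: ler_sum => i _.
rewrite coef_map normrM rmorphM rmorphXn normrX.
rewrite (ger0_norm (_ : 0 <= (p`_i)%:C%C)) ?ler0c //.
by rewrite ler_wpM2l ?ler0c // lerXn2r ?nnegrE // (le_trans (normr_ge0 z)).
Qed.

(** The first root after 0 is taken; the intermediate value theorem rules out both the absence of a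
    root below [b] and a negative value before the first root. *)
Lemma first_root (R : rcfType) (p : {poly R}) b :
    0 <= b -> 0 < p.[0] -> p.[b] < 0 ->
  exists rho, [/\ 0 < rho, rho <= b, p.[rho] = 0
    & forall x, 0 <= x < rho -> 0 < p.[x]].
Proof.
move=> b_ge0 p0 pb.
have pn0 : p != 0 by apply: contraTneq p0 => ->; rewrite horner0 ltxx.
have b_gt0 : 0 < b.
  by rewrite lt_neqAle b_ge0 andbT; apply: contraTneq pb => <-; rewrite -leNgt ltW.
have noivt a c : p.[a] * p.[c] < 0 -> a <= c -> ~ (forall x, a < x < c -> ~~ root p x).
  move=> pac ac H; have [x] := poly_ivtoo ac pac.
  by rewrite in_itv /= => xac /(negP (H x xac)).
case: (next_rootP p 0 b) (next_root_gt b_gt0 pn0) => [/eqP|rho _ rho0|c _].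
- by rewrite (negbTE pn0).
- rewrite in_itv /= => /andP[_ rhob] noroot rho_gt0; exists rho; split; rewrite ?(ltW rhob) //.
  move=> x /andP[x0 xrho]; rewrite ltNge; apply/negP => px.
  have [x_eq0|x_neq0] := eqVneq x 0; first by rewrite x_eq0 leNgt p0 in px.
  have nrx : ~~ root p x.
    by apply: noroot; rewrite in_itv /= xrho lt_neqAle eq_sym x_neq0 x0.
  have px0 : p.[x] < 0 by rewrite lt_neqAle px andbT.
  apply: (@noivt 0 x) => // [|y /andP[y0 yx]]; first by rewrite pmulr_rlt0.
  by apply: noroot; rewrite in_itv /= y0 (lt_trans yx).
- move=> cE noroot _; exfalso; apply: (@noivt 0 b) => //.
  by rewrite pmulr_rlt0.
Qed.

Section DominantRoot.
Variables (R : rcfType) (h : fps R) (Delta : {poly R}) (rho : R).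
Hypothesis h0 : h 0%N = 0.
Hypothesis h_gt0 : forall n, 0 < h n.+1.
Hypothesis sqr_h : (1 - h) ^+ 2 = fps_poly Delta.
Hypothesis rho_gt0 : 0 < rho.
Hypothesis Delta_rho : Delta.[rho] = 0.
Hypothesis Delta_gt0 : forall x : R, 0 <= x < rho -> 0 < Delta.[x].

(** Polynomial truncations replace [h], so that no convergence question arises: [tail N] is the
    excess of the squared truncation over [Delta]. *)
Let hN N := fps_trunc h N.+1.
Let tail N := (1 - hN N) ^+ 2 - Delta.

Local Notation toC := (map_poly (real_complex R)).

Lemma coef_h_ge0 n : 0 <= h n.
Proof. by case: n => [|n]; rewrite ?h0 // ltW. Qed.

Lemma hN_ge0 N n : 0 <= (hN N)`_n.
Proof. by rewrite coef_poly; case: ifP => // _; exact: coef_h_ge0. Qed.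

Lemma tail_low N n : (n <= N)%N -> (tail N)`_n = 0.
Proof.
move=> nN; rewrite coefB -[Delta`_n]/(fps_poly Delta n) -sqr_h expr2 expr2.
rewrite [X in _ - X](@fps_mul_trunc _ _ _ n N.+1) //.
have -> : fps_trunc (1 - h) N.+1 = 1 - hN N; last by rewrite subrr.
apply/polyP => i; rewrite coefB !coef_poly coef1 fpsBE fps1E.
by case: ltnP => //; case: i => // i _; rewrite subr0.
Qed.

(** Up to degree [N] the truncation is exact. Beyond it neither [Delta] nor [1 - 2 h_N] contributes,
    and only coefficients of [h_N^2] are left. *)
Lemma tail_ge0 N n : (size Delta <= N.+1)%N -> 0 <= (tail N)`_n.
Proof.
move=> sizeN; case: (leqP n N) => [/tail_low -> //|nN].
rewrite coefB [Delta`_n]nth_default ?subr0; last exact: leq_trans nN.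
rewrite (_ : (1 - hN N) ^+ 2 = 1 - hN N - hN N + hN N * hN N); last by ring.
rewrite coefD !coefB coef1 [(hN N)`_n]nth_default; last first.
  exact: leq_trans (size_poly _ _) nN.
rewrite -[n]prednK ?(leq_trans _ nN) // !subr0 add0r coefM.
by apply: sumr_ge0 => i _; rewrite mulr_ge0 ?hN_ge0.
Qed.

Lemma horner_tail N x : (1 - (hN N).[x]) ^+ 2 = Delta.[x] + (tail N).[x].
Proof. by rewrite /tail !(hornerD, hornerN) horner_exp !(hornerD, hornerN) hornerC; ring. Qed.

Lemma hN_horner0 N : (hN N).[0] = 0.
Proof. by rewrite horner_coef0 coef_poly h0. Qed.

(** Otherwise [h_N(x) = 1] for some [0 < x < rho], where [Delta(x) + tail(x) = 0] although
    [Delta(x) > 0] and [tail(x) >= 0]. *)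
Lemma hN_le1 N : (size Delta <= N.+1)%N -> (hN N).[rho] <= 1.
Proof.
move=> sizeN; rewrite leNgt; apply/negP => hN_gt1.
have [||x] := @poly_ivtoo _ (1 - hN N) 0 rho; first exact: ltW.
  by rewrite !hornerE hN_horner0 subr0 mul1r subr_lt0.
rewrite in_itv /= => /andP[x_gt0 x_lt].
rewrite /root !hornerE => /eqP root_x.
have := horner_tail N x; rewrite root_x expr0n /= => /esym/eqP.
have tail_x : 0 <= (tail N).[x].
  by apply: horner_coef_ge0 (ltW x_gt0) => n; exact: tail_ge0.
have := @Delta_gt0 x; rewrite x_lt ltW // => /(_ isT) Delta_x.
by rewrite gt_eqF // ltr_wpDr.
Qed.

(** Strictness comes from the next, positive, coefficient of [h]. *)
Lemma hN_lt1 N : (size Delta <= N.+1)%N -> (hN N).[rho] < 1.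
Proof.
move=> sizeN; apply: lt_le_trans (@hN_le1 N.+1 (leqW sizeN)).
rewrite !horner_poly [ltRHS]big_ord_recr /= ltrDl mulr_gt0 ?h_gt0 //.
exact: exprn_gt0.
Qed.

(* Compare [(1 - H_N)^2 = Delta + T] with [T >= 0] at [z] and at [rho]: this gives
   [|1 - H_N(z)| <= 1 - H_N(rho)], while [Re z < rho] would make
   [Re (1 - H_N(z)) > 1 - H_N(rho)]. *)
Lemma root_Delta_eq (z : R[i]) :
  root (toC Delta) z -> `|z| <= rho%:C%C -> z = rho%:C%C.
Proof.
move=> /rootP Dz z_le; pose N := (size Delta).+1.
have sizeN : (size Delta <= N.+1)%N by rewrite /N; lia.
have Re_le (w : R[i]) (x : R) : `|w| <= x%:C%C -> complex.Re w <= x.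
  move=> wx; rewrite -lecR; apply: le_trans wx; apply: le_trans (normc_ge_Re w).
  by rewrite lecR ler_norm.
have rho_ge0 := ltW rho_gt0.
have e_ge0 : 0 <= 1 - (hN N).[rho] by rewrite subr_ge0 hN_le1.
have sqr_le : `|1 - (toC (hN N)).[z]| <= (1 - (hN N).[rho])%:C%C.
  rewrite -(@ler_pXn2r _ 2) ?nnegrE ?normr_ge0 ?ler0c //.
  rewrite -normrX -rmorphXn horner_tail Delta_rho add0r.
  have -> : (1 - (toC (hN N)).[z]) ^+ 2 = (toC (tail N)).[z].
    rewrite /tail rmorphB rmorphXn rmorphB rmorph1 !(hornerD, hornerN).
    by rewrite Dz subr0 horner_exp !(hornerD, hornerN) hornerC.
  by apply: ler_normc_horner => // n; exact: tail_ge0.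
have Re_hN : (hN N).[rho] <= complex.Re (toC (hN N)).[z].
  by have := Re_le _ _ sqr_le; rewrite raddfB /= lerBlDr; lra.
have Re_term i : complex.Re ((h i)%:C%C * z ^+ i) <= h i * rho ^+ i.
  apply: Re_le; rewrite normrM (ger0_norm (_ : 0 <= (h i)%:C%C)) ?ler0c ?coef_h_ge0 //.
  rewrite rmorphM rmorphXn ler_wpM2l ?ler0c ?coef_h_ge0 // normrX.
  by rewrite lerXn2r ?nnegrE ?normr_ge0 ?ler0c.
have hNC : (toC (hN N)).[z] = \sum_(i < N.+1) (h i)%:C%C * z ^+ i.
  rewrite (@horner_coef_wide _ N.+1) ?size_map_poly ?size_poly //.
  by apply: eq_bigr => i _; rewrite coef_map coef_poly ltn_ord.
move: Re_hN; rewrite hNC raddf_sum horner_poly -subr_ge0 -sumrB.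
rewrite big_ord_recl big_ord_recl /= /bump /= h0 !expr1.
have rest_le0 : \sum_(i < N.-1)
    (complex.Re ((h i.+2)%:C%C * z ^+ i.+2) - h i.+2 * rho ^+ i.+2) <= 0.
  by apply: sumr_le0 => i _; rewrite subr_le0.
rewrite mul0r subr0 mul0r subrr add0r -/N => sum_ge0.
have Re1 : complex.Re ((h 1%N)%:C%C * z) = h 1%N * complex.Re z.
  by case: (z) => a b /=; rewrite mul0r subr0.
(* Every term at [z] has real part at most its value at [rho], and the total difference is
   nonnegative, so the linear term alone forces [Re z >= rho]. *)
have Re_ge : rho <= complex.Re z.
  rewrite -(@ler_pM2l _ (h 1%N)) // -subr_ge0 -Re1.
  by apply: le_trans sum_ge0 _; rewrite gerDl.
move: z_le Re_ge; rewrite normc_def lecR; case: (z) => a b /= norm_le a_ge.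
have : a ^+ 2 + b ^+ 2 <= rho ^+ 2.
  rewrite -ler_sqrt ?sqr_ge0 ?addr_ge0 ?sqr_ge0 //.
  by rewrite sqrtr_sqr ger0_norm.
move=> sqr_ab; have a_eq : a = rho.
  by apply/eqP; rewrite eq_le a_ge andbT -ler_sqr ?nnegrE //; nra.
move: sqr_ab; rewrite a_eq gerDl => b_le0.
have /eqP -> : b == 0 by rewrite -sqrf_eq0 eq_le b_le0 sqr_ge0.
by []. Qed.

(** Differentiate [(1 - h_N)^2 = Delta + tail] at [rho]: the left side gives
    [-2 h_N'(rho) (1 - h_N(rho)) < 0], and the tail has a nonnegative derivative. In particular the
    root [rho] is simple. *)
Lemma Delta_deriv_lt0 : Delta^`().[rho] < 0.
Proof.
pose N := (size Delta).
have sizeN : (size Delta <= N.+1)%N by rewrite /N; lia.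
have deriv_ge0 (p : {poly R}) : (forall n, 0 <= p`_n) -> 0 <= p^`().[rho].
  move=> p_ge0; apply: horner_coef_ge0 (ltW rho_gt0) => n.
  by rewrite coef_deriv mulrn_wge0.
have tail_deriv := deriv_ge0 _ (fun n => @tail_ge0 N n sizeN).
have h1_gt0 : 0 < (hN N)^`().[rho].
  (* [Delta] is nonzero, so [N >= 1] and the truncation keeps the linear term [h_1 X]. *)
  have size1 : (0 < N)%N.
    rewrite /N lt0n size_poly_eq0; apply: contraTneq (@Delta_gt0 0 _) => [->|].
      by rewrite horner0 ltxx.
    by rewrite lexx.
  have -> : hN N = (hN N - h 1%N *: 'X) + h 1%N *: 'X by rewrite subrK.
  rewrite derivD derivZ derivX !hornerE ltr_wpDl // deriv_ge0 // => n.
  rewrite coefB coefZ coefX coef_poly; case: ltnP => [_|/=].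
    by case: eqP => [->|_]; rewrite ?mulr1 ?subrr // mulr0 subr0 coef_h_ge0.
  by case: n => [|[|n]] //=; rewrite ?mulr0 ?subr0 // ltnS leqNgt size1.
have tailE : (tail N)^`().[rho] =
    - (2 * ((hN N)^`().[rho] * (1 - (hN N).[rho]))) - Delta^`().[rho].
  rewrite /tail expr2 derivB derivM derivB derivC !(hornerD, hornerN, hornerM).
  rewrite !hornerC; ring.
have e_gt0 : 0 < 1 - (hN N).[rho] by rewrite subr_gt0 hN_lt1.
have := mulr_gt0 h1_gt0 e_gt0.
move: tail_deriv; rewrite tailE.
by set m := (_^`().[rho] * _); lra.
Qed.

End DominantRoot.

(** * Logarithmic derivatives and power sums of inverse roots *)

Section PowerSums.
Variable R : comNzRingType.

(** The series [aX / (1 - aX)], that is [- theta (1 - aX) / (1 - aX)]; hence the constant term is 0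
    and not [a^0]. *)
Definition fps_geom (a : R) : fps R := Fps (fun n => if n is 0 then 0 else a ^+ n).

Lemma fps_geomE a :
  fps_poly (1 - a%:P * 'X) * fps_geom a = fps_poly (a%:P * 'X).
Proof.
rewrite rmorphB rmorph1 mulrBl mul1r rmorphM -mulrA; apply/fpsP => n.
rewrite fpsBE !fps_polyCM.
case: n => [|[|n]]; rewrite ?fps_polyXM0 ?fps_polyXM /= ?coefCM ?coefX ?mulr0 ?subr0 ?mulr1 //.
by rewrite [X in X - _]exprS subrr.
Qed.

(* Newton's identities, as a logarithmic derivative. *)
Lemma fps_theta_prod (s : seq R) :
  let P := \prod_(a <- s) (1 - a%:P * 'X) in
  - fps_theta (fps_poly P) = fps_poly P * \sum_(a <- s) fps_geom a.
Proof.
elim: s => [|a s]; first by rewrite /= !big_nil rmorph1 fps_theta1 oppr0 mul1r.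
rewrite /= !big_cons; set P := \prod_(b <- s) _; set G := \sum_(b <- s) _ => IH.
rewrite rmorphM fps_thetaM opprD -[- (fps_poly _ * _)]mulrN IH.
have -> : fps_theta (fps_poly (1 - a%:P * 'X)) = - fps_poly (a%:P * 'X).
  rewrite fps_theta_poly derivB derivC derivM derivC derivX mul0r !add0r mulr1.
  by rewrite mulrN mulrC rmorphN.
by rewrite -fps_geomE; ring.
Qed.

End PowerSums.

(** Since [p(0) = 1], no root vanishes and [X - z = -z (1 - X/z)]; the constants [-z] and the
    leading coefficient multiply to [p(0) = 1]. *)
Lemma unit_poly_factor (F : closedFieldType) (p : {poly F}) : p.[0] = 1 ->
  exists2 r : seq F, {in r, forall z, root p z}
    & p = \prod_(z <- r) (1 - z^-1%:P * 'X).
Proof.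
move=> p0; have [r pE] := closed_field_poly_normal p.
have c_neq0 : lead_coef p != 0.
  by rewrite lead_coef_eq0; apply: contra_eq_neq p0 => ->; rewrite horner0 eq_sym oner_neq0.
have rootr : {in r, forall z, root p z}.
  by move=> z zr; rewrite pE rootZ // root_prod_XsubC.
exists r => //.
have factor : \prod_(z <- r) ('X - z%:P) =
    (\prod_(z <- r) - z)%:P * \prod_(z <- r) (1 - z^-1%:P * 'X).
  rewrite rmorph_prod -big_split /=; apply: eq_big_seq => z zr.
  have z_neq0 : z != 0.
    by apply: contraTneq (rootr z zr) => ->; rewrite /root p0 oner_neq0.
  rewrite mulrBr mulr1 mulrA -polyCM mulNr divff // polyCN polyCN polyC1.
  by rewrite mulNr mul1r opprK addrC.
move: p0; rewrite [in X in X -> _]pE factor -mul_polyC mulrA -polyCM hornerM hornerC.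
have -> : (\prod_(z <- r) (1 - z^-1%:P * 'X)).[0] = 1.
  by rewrite horner_prod big1 // => z _; rewrite !hornerE ?mulr0 ?subr0.
rewrite mulr1 => c1.
by rewrite [LHS]pE factor -mul_polyC mulrA -polyCM c1 mul1r.
Qed.

(** By Newton's identities the coefficients are the power sums of the inverse roots of [Phi], all of
    modulus below [1/rho]. So [kappa] is a common bound on these moduli, still below [1/rho], and
    [C] is the number of roots. *)
Lemma log_deriv_bound (R : rcfType) (Phi : {poly R}) (rho : R) :
    Phi.[0] = 1 -> 0 < rho ->
    (forall z : R[i], root (map_poly (real_complex R) Phi) z -> rho%:C%C < `|z|) ->
  exists kappa C : R, [/\ 0 < kappa, kappa * rho < 1, 0 <= C &
    forall n, `|(- fps_theta (fps_poly Phi) * fps_inv (fps_poly Phi)) n|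
                <= C * kappa ^+ n].
Proof.
move=> Phi0 rho_gt0 big_roots.
set psi := - _ * _.
have [|r rootr PhiE] := @unit_poly_factor _ (map_poly (real_complex R) Phi).
  by rewrite -(rmorph0 (real_complex R)) horner_map Phi0 rmorph1.
have [kappa [kappa_gt0 kappa_rho le_kappa]] : exists kappa : R,
    [/\ 0 < kappa, kappa * rho < 1 & {in r, forall z, `|z^-1| <= kappa%:C%C}].
  have {rootr PhiE} : {in r, forall z, rho%:C%C < `|z|}.
    by move=> z /rootr /big_roots.
  elim: r => [_|z r IH rho_lt].
    exists (rho^-1 / 2); split=> //; first by rewrite divr_gt0 ?invr_gt0.
    by rewrite mulrAC mulVf ?gt_eqF //; lra.
  have [|kappa [kappa_gt0 kappa_rho le_kappa]] := IH.
    by move=> y yr; apply: rho_lt; rewrite inE yr orbT.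
  have := rho_lt z (mem_head _ _); rewrite normc_def ltcR.
  set m := Num.sqrt _ => rho_m; have m_gt0 : 0 < m := lt_trans rho_gt0 rho_m.
  have normz : `|z^-1| = (m^-1)%:C%C by rewrite normfV normc_def fmorphV.
  exists (Num.max kappa m^-1); split; first by rewrite lt_max kappa_gt0.
    by rewrite maxr_pMl ?(ltW rho_gt0) // gt_max kappa_rho mulrC ltr_pdivrMr ?mul1r.
  move=> y; rewrite inE => /orP[/eqP ->|/le_kappa yk].
    by rewrite normz lecR le_max lexx orbT.
  by apply: le_trans yk _; rewrite lecR le_max lexx.
have Phi_val : fps_poly Phi 0%N = 1 by rewrite /= -horner_coef0.
have psiE : map_fps (real_complex R) psi = \sum_(z <- r) fps_geom z^-1.
  apply: (@fps_mulI _ (map_fps (real_complex R) (fps_poly Phi))).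
    by rewrite /= -horner_coef0 Phi0 rmorph1.
  rewrite -rmorphM /psi mulrCA fps_mulV // mulr1 rmorphN.
  rewrite [X in - X](map_fps_theta (real_complex R)) map_fps_poly.
  rewrite PhiE.
  have := fps_theta_prod [seq z^-1 | z <- r]; rewrite /= !big_map.
  by [].
exists kappa, (size r)%:R; split=> // n.
rewrite -lecR -[(`|psi n|)%:C%C]/((real_complex R) `|psi n|).
have -> : (real_complex R) `|psi n| = `|map_fps (real_complex R) psi n|.
  by rewrite /= normc_def /= expr0n addr0 sqrtr_sqr.
rewrite psiE fps_sumE; apply: le_trans (ler_norm_sum _ _ _) _.
rewrite rmorphM rmorph_nat mulr_natl.
have -> : (kappa ^+ n)%:C%C *+ size r = \sum_(z <- r) (kappa ^+ n)%:C%C.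
  by rewrite big_const_seq count_predT iter_addr_0.
rewrite big_seq [leRHS]big_seq; apply: ler_sum => z zr.
case: (n) => [|m]; first by rewrite normr0 expr0 ler01.
rewrite [fps_geom _ _]/= normrX rmorphXn lerXn2r ?nnegrE ?normr_ge0 ?ler0c ?(ltW kappa_gt0) //.
exact: le_kappa.
Qed.

(** * Counting expressions *)

Section Enumeration.
Variable k : nat.

Lemma size_exprs_upto n : size (exprs_upto k n) = n.+1.
Proof. by elim: n => //= n IH; rewrite size_rcons IH. Qed.

Lemma nth_exprs_upto i n : (i <= n)%N -> nth [::] (exprs_upto k n) i = exprs k i.
Proof.
elim: n => [|n IH]; first by rewrite leqn0 => /eqP ->.
rewrite leq_eqVlt => /predU1P[-> //|i_n].
by rewrite /= nth_rcons size_exprs_upto i_n IH.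
Qed.

Lemma exprsS n : exprs k n.+1 =
  (if n == 0%N then Eps :: map (@Sym k) (enum 'I_k) else [::])
  ++ map (@Star k) (exprs k n)
  ++ flatten [seq [seq Plus a b | a <- exprs k i, b <- exprs k (n - i)]
                  ++ [seq Cat a b | a <- exprs k i, b <- exprs k (n - i)]
             | i <- iota 1 n.-1].
Proof.
rewrite /exprs /= nth_rcons size_exprs_upto ltnn eqxx -/(exprs k n).
do 2!congr (_ ++ _); congr flatten; apply/eq_in_map => i.
rewrite mem_iota => i_n; rewrite !nth_exprs_upto ?leq_subr //.
by move: i_n; case: (n) => [|m] /=; lia.
Qed.

Variable R : comNzRingType.
Implicit Types f g : rexp k -> R.

(** Arbitrary weights let one root decomposition serve for counting expressions, letters and
    Sigma-star expressions alike. *)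
Definition gen f : fps R := Fps (fun n => \sum_(e <- exprs k n) f e).

Lemma gen0 f : gen f 0%N = 0.
Proof. by rewrite /= big_nil. Qed.

Lemma genB f g : gen (fun e => f e - g e) = gen f - gen g.
Proof. by apply/fpsP => n; rewrite fpsBE /= sumrB. Qed.

Lemma genZ c f : gen (fun e => c * f e) = fps_poly c%:P * gen f.
Proof. by apply/fpsP => n; rewrite fps_polyCM /= mulr_sumr. Qed.

Lemma genS f n : gen f n.+1 =
  (if n is 0 then f Eps + \sum_(a : 'I_k) f (Sym a) else 0)
  + gen (fun e => f (Star e)) n
  + \sum_(i < n.+1) \sum_(a <- exprs k i) \sum_(b <- exprs k (n - i))
      (f (Plus a b) + f (Cat a b)).
Proof.
rewrite [LHS]/= exprsS !big_cat big_map /= addrA; congr (_ + _ + _).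
  by case: (n) => [|m] /=; rewrite ?big_nil // big_cons big_map big_enum.
pose F i := \sum_(a <- exprs k i) \sum_(b <- exprs k (n - i)) (f (Plus a b) + f (Cat a b)).
have flatE : \sum_(e <- flatten [seq [seq Plus a b | a <- exprs k i, b <- exprs k (n - i)]
                  ++ [seq Cat a b | a <- exprs k i, b <- exprs k (n - i)]
             | i <- iota 1 n.-1]) f e = \sum_(i <- iota 1 n.-1) F i.
  rewrite big_flatten big_map; apply: eq_bigr => i _.
  rewrite big_cat !big_allpairs_dep /= /F -big_split; apply: eq_bigr => a _.
  by rewrite -big_split.
(* There is no expression of size 0, so the sum over [1 <= i < n] extends to the range [0 <= i <= n]
   of a Cauchy product. *)
have F0 : F 0%N = 0 by rewrite /F /= big_nil.
have Fn : F n = 0 by rewrite /F subnn; apply: big1 => a _; rewrite /= big_nil.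
rewrite flatE -(big_mkord xpredT F) big_ltn // F0 add0r.
case: n F F0 Fn {flatE} => [|m] F F0 Fn; first by rewrite big_geq // big_nil.
by rewrite big_nat_recr //= Fn addr0 /index_iota subn1.
Qed.

Lemma genM f g n : \sum_(i < n.+1) \sum_(a <- exprs k i) \sum_(b <- exprs k (n - i))
  f a * g b = (gen f * gen g) n.
Proof.
rewrite fpsME; apply: eq_bigr => i _ /=; rewrite mulr_suml.
by apply: eq_bigr => a _; rewrite mulr_sumr.
Qed.

(** Each binary constructor is allowed two products because the letter weight obeys a Leibniz rule;
    other weights pad with zeros. *)
Lemma gen_eq f fs c p1 q1 p2 q2 p3 q3 p4 q4 :
    f Eps + \sum_(a : 'I_k) f (Sym a) = c ->
    (forall e, f (Star e) = fs e) ->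
    (forall a b, f (Plus a b) = p1 a * q1 b + p2 a * q2 b) ->
    (forall a b, f (Cat a b) = p3 a * q3 b + p4 a * q4 b) ->
  gen f = fps_poly 'X * (fps_poly c%:P + gen fs + (gen p1 * gen q1 + gen p2 * gen q2)
                        + (gen p3 * gen q3 + gen p4 * gen q4)).
Proof.
move=> f_atom f_star f_plus f_cat; apply/fpsP => -[|n].
  by rewrite gen0 fps_polyXM0.
rewrite genS fps_polyXM !fpsDE -!genM -addrA -addrA -addrA.
congr (_ + (_ + _)).
- by rewrite f_atom [RHS]/= coefC; case: n.
- by rewrite /=; apply: eq_bigr => e _.
- rewrite -!big_split; apply: eq_bigr => i _ /=.
  rewrite -!big_split; apply: eq_bigr => a _ /=.
  rewrite -!big_split; apply: eq_bigr => b _ /=.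
  by rewrite f_plus f_cat.
Qed.

End Enumeration.

Lemma exprs_size k n : all (fun e => rsize e == n) (exprs k n).
Proof.
elim/ltn_ind: n => -[//|n IH]; rewrite exprsS !all_cat all_map.
apply/and3P; split.
- by case: n {IH} => //=; rewrite all_map; apply/allP.
- by apply: sub_all (IH n (ltnSn n)) => e /=; rewrite eqSS.
- have all_flat p (ss : seq (seq (rexp k))) : all p (flatten ss) = all (all p) ss.
    by elim: ss => //= s ss IHs; rewrite all_cat IHs.
  rewrite all_flat all_map; apply/allP => i; rewrite mem_iota => i_n /=.
  have [i_lt ni_lt] : (i < n.+1)%N /\ (n - i < n.+1)%N.
    by move: i_n; case: (n) => [|m] /=; lia.
  have i_le : (i <= n)%N by [].
  have IHb := IH _ ni_lt; have IHa := IH _ i_lt.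
  rewrite all_cat; apply/andP; split; rewrite all_flat all_map;
    apply: sub_all IHa => a /eqP a_i; rewrite /= all_map;
    by apply: sub_all IHb => b /eqP b_ni; rewrite /= a_i b_ni subnKC.
Qed.

(** * Unions of letters and Sigma-star expressions *)

Section UnionLetters.
Variable k : nat.
Implicit Types e : rexp k.

(** A union of [m] letters contains [m - 1] signs [+] and so has size [2m - 1]; the successor avoids
    a truncated subtraction. *)
Lemma union_letters_size e w : union_letters e = Some w ->
  (rsize e).+1 = (size w).*2 /\ nletters e = size w.
Proof.
elim: e w => //= [a|a IHa b IHb] w; first by case=> <-.
case Ea: (union_letters a) => [u|//]; case Eb: (union_letters b) => [v|//] [<-].
by have [] := IHa _ Ea; have [] := IHb _ Eb; rewrite size_cat doubleD; lia.
Qed.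

Lemma union_letters_re_na e : union_letters e -> re_na e.
Proof.
have no_star t w : union_letters t = Some w -> ~~ sigma_star t by case: t.
elim: e => //= a IHa b IHb.
case Ea: (union_letters a) => [u|//]; case Eb: (union_letters b) => [v|//] _.
by rewrite (no_star _ _ _ Ea) (no_star _ _ _ Eb) IHa ?Ea // IHb ?Eb.
Qed.

Lemma sigma_starP e : sigma_star e ->
  [/\ re_na e, rsize e = k.*2 & nletters e = k].
Proof.
case: e => // e /=; case E: (union_letters e) => [w|//] /perm_size.
rewrite size_enum_ord => w_k.
have [-> ->] := union_letters_size E.
by rewrite w_k; split=> //; apply: union_letters_re_na; rewrite E.
Qed.

End UnionLetters.

Lemma big_seq_all0 (T : Type) (V : nmodType) (p : pred T) (s : seq T) (f : T -> V) :
  all p s -> (forall e, p e -> f e = 0) -> \sum_(e <- s) f e = 0.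
Proof.
move=> + f0; elim: s => [|e s IH] /=; first by rewrite big_nil.
by move=> /andP[pe ps]; rewrite big_cons f0 // IH // addr0.
Qed.

(** * Functional equations and the number of Sigma-star expressions *)

Section GeneratingFunctions.
Variables (R : realFieldType) (k : nat).
Implicit Types e : rexp k.

Definition na_fun e : R := (re_na e)%:R.
Definition star_fun e : R := (sigma_star e)%:R.
Definition letter_fun e : R := (nletters e)%:R * na_fun e.
(** Letters may repeat here. This overcounts the bodies of Sigma-star expressions, but yields a
    quadratic equation from which [num_stars] can be bounded. *)
Definition union_fun e : R := (isSome (union_letters e))%:R.

Local Notation X := (fps_poly ('X : {poly R})).
Local Notation kf := (fps_poly (k%:R%:P : {poly R})).
Local Notation Rf := (gen na_fun).
Local Notation Sf := (gen star_fun).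
Local Notation Lf := (gen letter_fun).
Local Notation Tf := (gen union_fun).

Lemma gen_zero : gen (fun _ : rexp k => 0 : R) = 0.
Proof. by apply/fpsP => n; rewrite fps0E /=; apply: big1. Qed.

Lemma na_sub_star e : na_fun e - star_fun e = (re_na e && ~~ sigma_star e)%:R.
Proof.
rewrite /na_fun /star_fun; case E: (sigma_star e); last by rewrite andbT subr0.
by have [-> _ _] := sigma_starP E; rewrite subrr.
Qed.

Lemma letter_sub_star e : letter_fun e - k%:R * star_fun e =
  (nletters e)%:R * (na_fun e - star_fun e).
Proof.
rewrite /letter_fun mulrBr; congr (_ - _); rewrite /star_fun.
case E: (sigma_star e); last by rewrite !mulr0.
by have [_ _ ->] := sigma_starP E.
Qed.

Lemma na_plus (a b : rexp k) : na_fun (Plus a b) =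
  (na_fun a - star_fun a) * (na_fun b - star_fun b).
Proof.
rewrite !na_sub_star -natrM mulnb; congr (_%:R); rewrite /=.
by case: (sigma_star a); case: (sigma_star b); case: (re_na a); case: (re_na b).
Qed.

Lemma na_cat (a b : rexp k) : na_fun (Cat a b) = na_fun a * na_fun b.
Proof. by rewrite /na_fun -natrM mulnb. Qed.

Lemma sum_sym1 : \sum_(a : 'I_k) (1 : R) = k%:R.
Proof. by rewrite sumr_const card_ord. Qed.

Lemma na_gen_eq : Rf = X * (1 + kf + Rf + (Rf - Sf) ^+ 2 + Rf ^+ 2).
Proof.
rewrite [LHS](@gen_eq k R na_fun na_fun (1 + k%:R)
  (fun e => na_fun e - star_fun e) (fun e => na_fun e - star_fun e)
  (fun=> 0) (fun=> 0) na_fun na_fun (fun=> 0) (fun=> 0)) //.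
- by rewrite gen_zero genB rmorphD rmorph1 rmorphD rmorph1; ring.
- by rewrite /na_fun /= sum_sym1.
- by move=> a b; rewrite na_plus mul0r addr0.
- by move=> a b; rewrite na_cat mul0r addr0.
Qed.

Lemma letter_gen_eq : Lf = X * (kf + Lf + 2 * (Lf - kf * Sf) * (Rf - Sf) + 2 * Lf * Rf).
Proof.
rewrite [LHS](@gen_eq k R letter_fun letter_fun k%:R
  (fun e => letter_fun e - k%:R * star_fun e) (fun e => na_fun e - star_fun e)
  (fun e => na_fun e - star_fun e) (fun e => letter_fun e - k%:R * star_fun e)
  letter_fun na_fun na_fun letter_fun) //.
- by rewrite !genB genZ; ring.
- rewrite /letter_fun /= mul0r add0r -[RHS]sum_sym1.
  by apply: eq_bigr => a _; rewrite mul1r.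
- move=> a b; rewrite !letter_sub_star /letter_fun na_plus /= natrD; ring.
- move=> a b; rewrite /letter_fun na_cat /= natrD; ring.
Qed.

Lemma union_gen_eq : Tf = X * (kf + Tf ^+ 2).
Proof.
rewrite [LHS](@gen_eq k R union_fun (fun=> 0) k%:R union_fun union_fun
  (fun=> 0) (fun=> 0) (fun=> 0) (fun=> 0) (fun=> 0) (fun=> 0)) //.
- by rewrite gen_zero; ring.
- by rewrite /union_fun /= sum_sym1 add0r.
- move=> a b; rewrite mul0r addr0 /union_fun -natrM mulnb /=.
  by case: (union_letters a) (union_letters b) => [u|] [v|].
- by move=> a b; rewrite mul0r addr0.
Qed.

Lemma gen_ge0 (f : rexp k -> R) n : (forall e, 0 <= f e) -> 0 <= gen f n.
Proof. by move=> f_ge0; apply: sumr_ge0. Qed.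

Lemma star_gen_le_na n : Sf n <= Rf n.
Proof.
apply: ler_sum => e _; rewrite -subr_ge0 na_sub_star.
exact: ler0n.
Qed.

Lemma na_gen_gt0 n : 0 < Rf n.+1.
Proof.
elim: n => [|n IH].
  rewrite na_gen_eq fps_polyXM !fpsDE fps1E !expr2 !fpsME0 fpsBE !gen0 /= coefC /=.
  by rewrite subrr mulr0 !addr0 ltr_pwDl.
have kfS : kf n.+1 = 0 by rewrite /= coefC.
rewrite na_gen_eq fps_polyXM !fpsDE fps1E kfS !add0r -addrA ltr_pwDl //.
have sqr_ge0 (f : fps R) : (forall m, 0 <= f m) -> 0 <= (f ^+ 2) n.+1.
  by move=> f_ge0; rewrite expr2 fpsME sumr_ge0 // => i _; rewrite mulr_ge0.
apply: addr_ge0; apply: sqr_ge0 => m; first by rewrite fpsBE subr_ge0 star_gen_le_na.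
by apply: gen_ge0 => e; exact: ler0n.
Qed.

Definition num_stars : R := Sf k.*2.

Lemma star_gen_poly : Sf = fps_poly (num_stars%:P * 'X^(k.*2)).
Proof.
apply/fpsP => n; rewrite [RHS]/= coefCM coefXn.
have [->|n_neq] := eqVneq n k.*2; first by rewrite mulr1.
rewrite mulr0; apply: big_seq_all0 (exprs_size k n) _ => e /eqP e_n.
rewrite /star_fun; case E: (sigma_star e) => //.
by have [_ e_2k _] := sigma_starP E; rewrite -e_n e_2k eqxx in n_neq.
Qed.

(** The bound [2kx] reproduces itself: if a partial sum is at most [2kx], the equation
    [T = X (k + T^2)] bounds the next one by [x (k + (2kx)^2)], which is at most [2kx] as
    [4kx^2 <= 1]. *)
Lemma union_gen_bound (x : R) N : 0 <= x -> 4 * k%:R * x ^+ 2 <= 1 ->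
  \sum_(n < N) Tf n * x ^+ n <= 2 * k%:R * x.
Proof.
move=> x_ge0 x_le.
have T_ge0 n : 0 <= Tf n by apply: gen_ge0 => e; exact: ler0n.
have sum_ge0 M : 0 <= \sum_(n < M) Tf n * x ^+ n.
  by apply: sumr_ge0 => n _; rewrite mulr_ge0 ?exprn_ge0.
have k_ge0 : 0 <= k%:R :> R := ler0n _ _.
elim: N => [|N IH]; first by rewrite big_ord0 !mulr_ge0.
have sqr_le M : \sum_(n < M) (Tf ^+ 2) n * x ^+ n <= (\sum_(n < M) Tf n * x ^+ n) ^+ 2.
  pose P := fps_trunc Tf M; have P_ge0 n : 0 <= P`_n.
    by rewrite coef_poly; case: ifP.
  have P2_ge0 n : 0 <= (P ^+ 2)`_n.
    by rewrite expr2 coefM; apply: sumr_ge0 => i _; rewrite mulr_ge0.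
  have P2E n : (n < M)%N -> (P ^+ 2)`_n = (Tf ^+ 2) n.
    by move=> nM; rewrite !expr2 [RHS](@fps_mul_trunc _ Tf Tf n M).
  have PE : P.[x] = \sum_(n < M) Tf n * x ^+ n by rewrite horner_poly.
  rewrite -PE -horner_exp (@horner_coef_wide _ (maxn M (size (P ^+ 2)))) ?leq_maxr //.
  rewrite (big_ord_widen_cond _ xpredT (fun n => (Tf ^+ 2) n * x ^+ n)
    (leq_maxl M (size (P ^+ 2)))).
  rewrite big_mkcond; apply: ler_sum => n _ /=.
  have Pn_ge0 : 0 <= (P ^+ 2)`_n * x ^+ n.
    by rewrite mulr_ge0 ?exprn_ge0.
  case: ltnP => // nM.
  by rewrite P2E.
rewrite big_ord_recl gen0 mul0r add0r.
have -> : \sum_(i < N) Tf (lift ord0 i) * x ^+ lift ord0 i =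
    x * \sum_(i < N) (kf i * x ^+ i + (Tf ^+ 2) i * x ^+ i).
  rewrite mulr_sumr; apply: eq_bigr => i _.
  have TS : Tf i.+1 = kf i + (Tf ^+ 2) i by rewrite {1}union_gen_eq fps_polyXM fpsDE.
  by rewrite lift0 TS (exprS x) mulrCA -mulrDl.
have kf_le : \sum_(i < N) kf i * x ^+ i <= k%:R.
  case: (N) => [|M]; first by rewrite big_ord0.
  rewrite big_ord_recl [kf _]/= coefC mulr1 big1 ?addr0 // => i _.
  by rewrite [kf _]/= coefC mul0r.
have sq : (\sum_(n < N) Tf n * x ^+ n) ^+ 2 <= (2 * k%:R * x) ^+ 2.
  by rewrite lerXn2r ?nnegrE ?sum_ge0 ?mulr_ge0.
have -> : 2 * k%:R * x = x * (k%:R + k%:R) by ring.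
rewrite big_split ler_wpM2l //; apply: lerD => //.
apply: le_trans (sqr_le N) _; apply: le_trans sq _.
have -> : (2 * k%:R * x) ^+ 2 = k%:R * (4 * k%:R * x ^+ 2) by ring.
by rewrite -[leRHS]mulr1 ler_wpM2l.
Qed.

(** Removing the star leaves a union of size [2k - 1]. A single term of the bounded series gives
    [s x^(2k-1) <= 2kx]; a further factor [x] gives [2kx^2 <= 1/2]. *)
Lemma num_stars_le (x : R) : (0 < k)%N -> 0 <= x -> 4 * k%:R * x ^+ 2 <= 1 ->
  num_stars * x ^+ k.*2 <= 1 / 2.
Proof.
move=> k_gt0 x_ge0 x_le.
have [m k2] : exists m, k.*2 = m.+2 by exists (k.*2).-2; lia.
have starT : num_stars <= Tf m.+1.
  rewrite /num_stars k2 genS add0r [X in _ + X]big1 ?addr0; last first.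
    by move=> i _; rewrite big1 // => a _; rewrite big1 // => b _; rewrite addr0.
  apply: ler_sum => e _; rewrite /star_fun /union_fun ler_nat /=.
  by case: (union_letters e) => //= w; case: (perm_eq _ _).
have := union_gen_bound m.+2 x_ge0 x_le; rewrite big_ord_recr => bound.
have T_le : num_stars * x ^+ m.+1 <= 2 * k%:R * x.
  apply: le_trans bound; apply: le_trans (_ : Tf m.+1 * x ^+ m.+1 <= _).
    by rewrite ler_wpM2r ?exprn_ge0.
  rewrite lerDr; apply: sumr_ge0 => i _; apply: mulr_ge0; last exact: exprn_ge0.
  by apply: gen_ge0 => e; exact: ler0n.
rewrite k2 (exprSr x m.+1) mulrA; apply: le_trans (ler_wpM2r x_ge0 T_le) _.
have -> : 2 * k%:R * x * x = 4 * k%:R * x ^+ 2 / 2 by field.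
by rewrite ler_pM2r ?invr_gt0.
Qed.

End GeneratingFunctions.

From mathcomp Require Import classical_sets reals topology normedtype sequences.
From mathcomp Require Import Rstruct Rstruct_topology.
Import numFieldNormedType.Exports.
Local Open Scope classical_set_scope.

(** * Ratios of consecutive renewal coefficients *)

Lemma sum_arith_geom_le (R : realFieldType) (x : R) n :
  0 <= x < 1 -> \sum_(i < n) i.+1%:R * x ^+ i <= ((1 - x) ^+ 2)^-1.
Proof.
move=> /andP[x0 x1].
have x2 : 0 < (1 - x) ^+ 2 by rewrite exprn_gt0 // subr_gt0.
rewrite -[leRHS]mul1r ler_pdivlMr //.
suff -> : (\sum_(i < n) i.+1%:R * x ^+ i) * (1 - x) ^+ 2
    = 1 - x ^+ n - n%:R * x ^+ n * (1 - x).
  have xn := exprn_ge0 n x0; have := ler0n R n.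
  have := mulr_ge0 (mulr_ge0 (ler0n R n) xn) (_ : 0 <= 1 - x).
  by rewrite subr_ge0 => /(_ (ltW x1)); lra.
elim: n => [|n IH]; first by rewrite big_ord0 expr0; ring.
by rewrite big_ord_recr mulrDl IH /= -[n.+1]addn1 natrD exprD expr1; ring.
Qed.

(** Meant for [V = 1 / Delta], when it is [- theta Delta / Delta]; the inverse is a parameter
    because it is available as [U^2]. *)
Definition neg_log_deriv (R : comNzRingType) (Delta : {poly R}) (V : fps R) : fps R :=
  - fps_theta (fps_poly Delta) * V.

Section RenewalRatio.
Variables (R : realType) (h U : fps R) (Delta : {poly R}) (rho : R).
Hypothesis h0 : h 0%N = 0.
Hypothesis h_gt0 : forall n, 0 < h n.+1.
Hypothesis sqr_h : (1 - h) ^+ 2 = fps_poly Delta.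
Hypothesis rho_gt0 : 0 < rho.
Hypothesis Delta_rho : Delta.[rho] = 0.
Hypothesis Delta_gt0 : forall x : R, 0 <= x < rho -> 0 < Delta.[x].

Hypothesis one_sub_h_U : (1 - h) * U = 1.

Lemma renewal_val0 : U 0%N = 1.
Proof.
have := congr1 (fun f : fps R => f 0%N) one_sub_h_U.
by rewrite fpsME0 fpsBE fps1E h0 subr0 mul1r.
Qed.

Lemma renewal_rec n : U n.+1 = \sum_(i < n.+1) h i.+1 * U (n - i)%N.
Proof.
have UE : U = 1 + h * U.
  by have := one_sub_h_U; rewrite mulrBl mul1r => <-; ring.
by rewrite {1}UE fpsDE fps1E add0r fpsME big_ord_recl h0 mul0r add0r.
Qed.

Lemma renewal_gt0 n : 0 < U n.
Proof.
elim/ltn_ind: n => -[_|n IH]; first by rewrite renewal_val0.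
rewrite renewal_rec big_ord_recl ltr_wpDr ?mulr_gt0 ?IH ?subn0 //.
by apply: sumr_ge0 => i _; rewrite mulr_ge0 ?ltW // IH // ltnS leq_subr.
Qed.

(** Induction on [a] with the renewal equation: the first [a] terms of the recursion for [U (a + b)]
    already dominate [U a * U b]. *)
Lemma renewal_supermul a b : U a * U b <= U (a + b)%N.
Proof.
elim/ltn_ind: a => -[_|a IH]; first by rewrite renewal_val0 mul1r.
rewrite addSn !renewal_rec mulr_suml -addSn.
rewrite -(big_mkord xpredT (fun i => h i.+1 * U (a - i)%N * U b)).
rewrite -(big_mkord xpredT (fun i => h i.+1 * U (a + b - i)%N)).
rewrite [leRHS](big_cat_nat (n := a.+1)) //=; last by rewrite ltnS leq_addr.
apply: ler_wpDr.
  by apply: sumr_ge0 => i _; rewrite mulr_ge0 ?ltW ?renewal_gt0.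
apply: ler_sum_nat => i /andP[_ ia].
rewrite -mulrA ler_pM2l // -addnBAC //; apply: IH.
by rewrite ltnS leq_subr.
Qed.


Local Notation Q := (neg_log_deriv Delta (U ^+ 2)).

Lemma neg_log_derivE : Q = 2 * fps_theta h * U.
Proof.
have thetaD : fps_theta (fps_poly Delta) = - (2 * (1 - h) * fps_theta h).
  rewrite -sqr_h expr2 fps_thetaM fps_thetaD fps_thetaN fps_theta1; ring.
transitivity ((1 - h) * U * (2 * fps_theta h * U)); first by rewrite /neg_log_deriv thetaD; ring.
by rewrite one_sub_h_U mul1r.
Qed.

Lemma theta_renewal : 2 * fps_theta U = Q * U.
Proof.
have := congr1 (@fps_theta R) one_sub_h_U.
rewrite fps_thetaM fps_thetaD fps_thetaN fps_theta1 add0r => thetaE.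
have -> : fps_theta U = (1 - h) * U * fps_theta U by rewrite one_sub_h_U mul1r.
rewrite neg_log_derivE -[RHS]addr0 -(mulr0 (2 * U)) -thetaE; ring.
Qed.

Lemma neg_log_deriv_ge0 n : 0 <= Q n.
Proof.
rewrite neg_log_derivE -mulrA mulr_natl fpsMnE mulrn_wge0 // fpsME.
apply: sumr_ge0 => i _; rewrite mulr_ge0 ?(ltW (renewal_gt0 _)) //=.
by rewrite mulrn_wge0 // (coef_h_ge0 h0 h_gt0).
Qed.

(** All terms of the convolution [Q U = 2 theta U] are nonnegative, and one of them is [Q n * U 0].
    Read backwards, this bounds [U n] from below. *)
Lemma neg_log_deriv_le n : Q n <= 2 * (n%:R * U n).
Proof.
move: theta_renewal neg_log_deriv_ge0; move: (neg_log_deriv _ _) => q thetaE q_ge0.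
have -> : 2 * (n%:R * U n) = (2 * fps_theta U) n.
  by rewrite mulr_natl mulr_natl mulr_natl fpsMnE.
rewrite thetaE fpsME big_ord_recr /= subnn renewal_val0 mulr1 lerDr.
by apply: sumr_ge0 => i _; rewrite mulr_ge0 ?q_ge0 ?(ltW (renewal_gt0 _)).
Qed.

Lemma Delta_mul_renewal_sqr : fps_poly Delta * U ^+ 2 = 1.
Proof. by rewrite -sqr_h -exprMn one_sub_h_U expr1n. Qed.

Lemma Delta0 : Delta.[0] = 1.
Proof.
rewrite horner_coef0 -[Delta`_0]/(fps_poly Delta 0%N) -sqr_h expr2 fpsME0.
by rewrite fpsBE fps1E h0 subr0 mulr1.
Qed.

(** Write [Delta = (1 - X/rho) Phi]. Logarithmic derivatives add: the linear factor gives the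
    geometric part and [Phi] gives [psi]. As [rho] is a simple root of [Delta] and the only one of
    modulus at most [rho], all roots of [Phi] lie farther out. *)
Lemma neg_log_deriv_asymp : exists kappa C : R, [/\ 0 < kappa, kappa * rho < 1, 0 <= C &
  exists2 psi : fps R, Q = fps_geom rho^-1 + psi
    & forall n, `|psi n| <= C * kappa ^+ n].
Proof.
have rho_neq0 : rho != 0 by rewrite gt_eqF.
have /factor_theorem[q Delta_q] : root Delta rho by apply/eqP.
pose lin := 1 - rho^-1%:P * 'X.
have [Phi DeltaE] : exists Phi, Delta = lin * Phi.
  exists ((- rho)%:P * q).
  rewrite Delta_q /lin mulrCA mulrA -[LHS]mulrC; congr (_ * _).
  rewrite mulrBr mulr1 mulrA -polyCM mulNr divff // !polyCN polyC1.
  by rewrite mulN1r opprK addrC.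
have Phi0 : Phi.[0] = 1.
  have lin0 : lin.[0] = 1 by rewrite /lin !hornerE ?mulr0 ?subr0.
  by have := Delta0; rewrite DeltaE hornerM lin0 mul1r.
have Phi_rho : Phi.[rho] != 0.
  have deriv_lt0 : Delta^`().[rho] < 0.
    exact: (Delta_deriv_lt0 h0 h_gt0 sqr_h).
  apply: contraTneq deriv_lt0 => Phi_rho.
  rewrite DeltaE derivM hornerD !hornerM Phi_rho mulr0 add0r.
  by rewrite /lin !hornerE mulVf // subrr mul0r ltxx.
have big_roots (z : R[i]) :
    root (map_poly (real_complex R) Phi) z -> rho%:C%C < `|z|.
  move=> Phi_z; rewrite real_ltNge ?normr_real ?complex_real //=.
  apply/negP => z_le.
  have z_rho : z = rho%:C%C.
    apply: (root_Delta_eq h0 h_gt0 sqr_h rho_gt0 Delta_rho Delta_gt0) => //.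
    by rewrite DeltaE rmorphM rootM Phi_z orbT.
  move: Phi_z; rewrite z_rho /root horner_map fmorph_eq0.
  exact/negP.
have [kappa [C [kappa_gt0 kappa_rho C_ge0 psi_le]]] := log_deriv_bound Phi0 rho_gt0 big_roots.
exists kappa, C; split => //; exists (- fps_theta (fps_poly Phi) * fps_inv (fps_poly Phi)) => //.
have Phi_inv : fps_poly Phi * fps_inv (fps_poly Phi) = 1.
  by rewrite fps_mulV // -[LHS]horner_coef0.
have geomE : fps_poly lin * fps_geom rho^-1 = - fps_theta (fps_poly lin).
  by have := fps_theta_prod [:: rho^-1]; rewrite /= !big_seq1 => ->.
apply: (@fps_mulI _ (fps_poly Delta)); first by rewrite -[LHS]horner_coef0 Delta0.
transitivity (- fps_theta (fps_poly Delta) * (fps_poly Delta * U ^+ 2)).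
  by rewrite /neg_log_deriv; ring.
rewrite Delta_mul_renewal_sqr mulr1 DeltaE rmorphM fps_thetaM.
transitivity (fps_poly lin * fps_geom rho^-1 * fps_poly Phi - fps_poly lin *
   fps_theta (fps_poly Phi) * (fps_poly Phi * fps_inv (fps_poly Phi))); last by ring.
by rewrite geomE Phi_inv; ring.
Qed.

(** For large [n], [2 n U_n >= Q_n >= rho^(-n) - C kappa^n >= rho^(-n) / 2]. *)
Lemma renewal_lower : exists2 K, 0 < K & forall n, rho^-1 ^+ n <= K * (n.+1%:R * U n).
Proof.
have [kappa [C [kappa_gt0 kappa_rho C_ge0 [psi QG psi_le]]]] := neg_log_deriv_asymp.
have rho_ge0 := ltW rho_gt0.
have [J small] : exists J, forall n, (J <= n)%N -> C * (kappa * rho) ^+ n <= 1 / 2.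
  have kr_ge0 : 0 <= kappa * rho by rewrite mulr_ge0 ?ltW.
  have kr : `|kappa * rho| < 1 by rewrite ger0_norm.
  have lim0 : (fun n => C * (kappa * rho) ^+ n) @ \oo --> (0 : R).
    by rewrite -(mulr0 C); apply: cvgM; [exact: cvg_cst | exact: cvg_expr].
  have half_gt0 : 0 < 1 / 2 :> R by rewrite divr_gt0.
  have /cvgr0Pnorm_lt /(_ _ half_gt0) [J _ HJ] := lim0.
  exists J => n Jn; have := HJ n Jn; rewrite /= ger0_norm ?mulr_ge0 ?exprn_ge0 //.
  exact: ltW.
have term_ge0 i : 0 <= rho^-1 ^+ i / U i.
  by rewrite divr_ge0 ?exprn_ge0 ?invr_ge0 // ltW ?renewal_gt0.
(* The 4 serves for [n > J]; the sum of the ratios covers each of the finitely many [n <= J]. *)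
exists (4 + \sum_(i < J.+1) rho^-1 ^+ i / U i).
  by rewrite ltr_pwDl // sumr_ge0.
move=> n; have Un := renewal_gt0 n.
have n1 : 1 <= n.+1%:R :> R by rewrite ler1n.
case: (leqP n J) => nJ.
  apply: (@le_trans _ _ ((rho^-1 ^+ n / U n) * (1 * U n))).
    by rewrite mul1r divfK // gt_eqF.
  apply: ler_pM => //; first by rewrite mul1r ltW.
    rewrite (bigD1 (Ordinal (nJ : (n < J.+1)%N))) //=.
    by rewrite addrCA lerDl addr_ge0 // sumr_ge0.
  by rewrite ler_pM2r.
apply: (@le_trans _ _ (4 * (n%:R * U n))).
  have := neg_log_deriv_le n; rewrite QG fpsDE; case: n nJ Un n1 => // n nJ Un n1.
  rewrite [fps_geom _ _]/= => Qn.
  have := psi_le n.+1; rewrite ler_norml => /andP[psi_ge _].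
  have : C * kappa ^+ n.+1 <= rho^-1 ^+ n.+1 / 2.
    have -> : C * kappa ^+ n.+1 = rho^-1 ^+ n.+1 * (C * (kappa * rho) ^+ n.+1).
      by rewrite [RHS]mulrCA -exprMn [_^-1 * _]mulrCA mulVf ?mulr1 // gt_eqF.
    rewrite ler_wpM2l ?exprn_ge0 ?invr_ge0 //.
    by have := small _ (ltnW nJ); rewrite div1r.
  by move: Qn psi_ge; set u := U _; set w := rho^-1 ^+ _; set v := kappa ^+ _; lra.
apply: ler_pM => //; first by rewrite mulr_ge0 ?(ltW Un).
  by rewrite lerDl sumr_ge0.
by rewrite ler_wpM2r ?ltW // ltr_nat.
Qed.

(** Multiplying [2 theta U = Q U] by [1 - X/rho] turns the geometric part of [Q] into [X/rho] and
    leaves a recursion for [U_(n+1)] with error [(chi U)_(n+1)], where [chi = (1 - X/rho) psi]. The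
    error is at most a constant times [U_n], so division by [2 (n+1) U_n] gives [O(1/n)]. *)
Lemma renewal_ratio_bound : exists B, forall n, `|U n.+1 / U n - rho^-1| <= B / n.+1%:R.
Proof.
have [K K_gt0 K_le] := renewal_lower.
have [kappa [C [kappa_gt0 kappa_rho C_ge0 [psi QG psi_le]]]] := neg_log_deriv_asymp.
have rho_ge0 := ltW rho_gt0.
pose chi := psi - fps_poly 'X * (fps_poly rho^-1%:P * psi).
have [C' C'_ge0 chi_le] : exists2 C', 0 <= C' & forall n, `|chi n.+1| <= C' * kappa ^+ n.+1.
  exists (C * (1 + (rho * kappa)^-1)).
    by rewrite mulr_ge0 // addr_ge0 ?invr_ge0 ?mulr_ge0 // ltW.
  move=> n.
  rewrite fpsBE fps_polyXM fps_polyCM mulrDr mulr1 mulrDl.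
  apply: le_trans (ler_normB _ _) _; apply: lerD; first exact: psi_le.
  rewrite normrM ger0_norm ?invr_ge0 //.
  have -> : C / (rho * kappa) * kappa ^+ n.+1 = rho^-1 * (C * kappa ^+ n).
    by rewrite exprS; field; rewrite !gt_eqF.
  by rewrite ler_pM2l ?invr_gt0.
pose x := kappa * rho.
have x01 : 0 <= x < 1 by rewrite mulr_ge0 ?ltW.
pose M := C' * kappa * K * ((1 - x) ^+ 2)^-1.
have chiU n : `|(chi * U) n.+1| <= M * U n.
  (* As [psi], hence [chi], has no constant term, [(chi U)_(n+1)] involves only [U_0, ..., U_n] and
     can be compared with [U_n]. *)
  have psi0 : psi 0%N = 0.
    have := congr1 (fun f : fps R => f 0%N) QG.
    by rewrite fpsDE add0r => <-; rewrite /neg_log_deriv fpsME0 fpsNE /= mulr0n oppr0 mul0r.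
  have chi0 : chi 0%N = 0 by rewrite fpsBE fps_polyXM0 psi0 subr0.
  rewrite fpsME big_ord_recl chi0 mul0r add0r.
  apply: le_trans (ler_norm_sum _ _ _) _.
  apply: (@le_trans _ _ (C' * kappa * K * (\sum_(i < n.+1) i.+1%:R * x ^+ i) * U n)).
    rewrite mulr_sumr mulr_suml; apply: ler_sum => i _.
    rewrite /= /bump /= add1n subSS normrM (gtr0_norm (renewal_gt0 _)).
    apply: (@le_trans _ _ (C' * kappa ^+ i.+1 * U (n - i)%N)).
      by rewrite ler_pM2r ?renewal_gt0 //; exact: chi_le.
    (* Supermultiplicativity gives [U_(n-i) <= U_n / U_i], and the lower bound on [U_i] gives
       [1 / U_i <= K (i+1) rho^i]; what remains to be summed is [(i+1) x^i] with
       [x = kappa rho < 1]. *)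
    have Uni : U (n - i)%N * U i <= U n.
      by apply: le_trans (renewal_supermul _ _) _; rewrite subnK // -ltnS.
    have Ui : 1 <= K * (i.+1%:R * U i) * rho ^+ i.
      rewrite -(@ler_pM2l _ (rho^-1 ^+ i)) ?exprn_gt0 ?invr_gt0 //.
      by rewrite mulr1 mulrC mulrAC -mulrA -exprMn mulVf ?gt_eqF // expr1n mulr1.
    apply: (@le_trans _ _ (C' * kappa ^+ i.+1 * (K * i.+1%:R * rho ^+ i) *
              (U (n - i)%N * U i))).
      have -> : C' * kappa ^+ i.+1 * (K * i.+1%:R * rho ^+ i) * (U (n - i)%N * U i)
          = C' * kappa ^+ i.+1 * U (n - i)%N * (K * (i.+1%:R * U i) * rho ^+ i) by ring.
      by rewrite ler_peMr // !mulr_ge0 ?exprn_ge0 ?(ltW kappa_gt0) ?(ltW (renewal_gt0 _)).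
    have -> : C' * kappa * K * (i.+1%:R * x ^+ i) * U n =
        C' * kappa ^+ i.+1 * (K * i.+1%:R * rho ^+ i) * U n.
      by rewrite /x exprMn exprS; ring.
    by rewrite ler_wpM2l // !mulr_ge0 ?exprn_ge0 ?(ltW kappa_gt0) ?(ltW K_gt0).
  rewrite ler_pM2r ?renewal_gt0 // /M ler_wpM2l ?sum_arith_geom_le //.
  by rewrite !mulr_ge0 ?(ltW kappa_gt0) ?(ltW K_gt0).
have U_step n : 2 * (n.+1%:R * U n.+1) =
    rho^-1 * (2 * (n%:R * U n) + U n) + (chi * U) n.+1.
  pose lin : fps R := 1 - fps_poly 'X * fps_poly rho^-1%:P.
  have geomE : lin * fps_geom rho^-1 = fps_poly 'X * fps_poly rho^-1%:P.
    have := fps_geomE rho^-1; rewrite rmorphB rmorph1 rmorphM.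
    by move=> E; rewrite /lin [fps_poly 'X * _]mulrC E rmorphM.
  have E : lin * (2 * fps_theta U) = fps_poly 'X * (fps_poly rho^-1%:P * U) + chi * U.
    rewrite theta_renewal QG; transitivity (lin * fps_geom rho^-1 * U + lin * psi * U).
      by ring.
    by rewrite geomE /lin /chi; ring.
  have := congr1 (fun f : fps R => f n.+1) E.
  rewrite [RHS]fpsDE fps_polyXM fps_polyCM /lin mulrBl mul1r -mulrA fpsBE fps_polyXM.
  rewrite fps_polyCM !mulr_natl !fpsMnE -![fps_theta U _]/(U _ *+ _) => E'.
  by rewrite mulrDr -addrA -E' addrC subrK.
exists ((rho^-1 + M) / 2) => n.
have n_gt0 : 0 < n.+1%:R :> R by rewrite ltr0n.
have Un := renewal_gt0 n.
have -> : U n.+1 / U n - rho^-1 = ((chi * U) n.+1 / U n - rho^-1) / 2 / n.+1%:R.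
  apply: (mulfI (_ : n.+1%:R * 2 * U n != 0)).
    by rewrite !mulf_neq0 ?gt_eqF.
  have -> : n.+1%:R * 2 * U n * (U n.+1 / U n - rho^-1) =
    2 * (n.+1%:R * U n.+1) - n.+1%:R * 2 * U n / rho.
    by field; rewrite !gt_eqF.
  rewrite U_step -[n.+1]addn1 natrD; field.
  by rewrite natr1 !gt_eqF.
rewrite normrM normfV (gtr0_norm n_gt0) ler_pM2r ?invr_gt0 //.
rewrite normrM normfV (@ger0_norm _ 2) // ler_pM2r ?invr_gt0 // [leRHS]addrC.
apply: le_trans (ler_normB _ _) _; rewrite [`|rho^-1|]ger0_norm ?invr_ge0 //.
by rewrite lerD2r normrM normfV (gtr0_norm Un) ler_pdivrMr.
Qed.

Lemma renewal_ratio_cvg : (fun n => U n / U n.+1) @ \oo --> rho.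
Proof.
have [B HB] := renewal_ratio_bound.
have cvg1 : (fun n => U n.+1 / U n) @ \oo --> rho^-1.
  apply/subr_cvg0; apply: norm_cvg0.
  apply: (@squeeze_cvgr _ _ _ _ (fun=> 0) (fun n => B * harmonic n)).
  - by near=> n; rewrite normr_ge0 HB.
  - exact: cvg_cst.
  - by rewrite -(mulr0 B); apply: cvgM; [exact: cvg_cst | exact: cvg_harmonic].
have -> : (fun n => U n / U n.+1) = (fun n => (U n.+1 / U n)^-1).
  by apply/funext => n; rewrite invf_div.
by rewrite -[X in _ --> X]invrK; apply: cvgV; rewrite // invr_eq0 gt_eqF.
Unshelve. all: by end_near.
Qed.

(** Induction along Horner's scheme: a factor [X] shifts the index, which costs the factor
    [U_n / U_(n+1)], and this tends to [rho]. *)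
Lemma poly_mul_renewal_cvg (A : {poly R}) : (fun n => (fps_poly A * U) n / U n) @ \oo --> A.[rho].
Proof.
elim/poly_ind: A => [|A c IH].
  under eq_fun do rewrite rmorph0 mul0r fps0E mul0r.
  by rewrite horner0; exact: cvg_cst.
rewrite -cvg_shiftS.
have step n : (fps_poly (A * 'X + c%:P) * U) n.+1 / U n.+1 =
    (fps_poly A * U) n / U n * (U n / U n.+1) + c.
  have -> : fps_poly (A * 'X + c%:P) * U = fps_poly 'X * (fps_poly A * U) + fps_poly c%:P * U.
    by rewrite rmorphD rmorphM; ring.
  rewrite fpsDE fps_polyXM fps_polyCM; field.
  by rewrite !gt_eqF ?renewal_gt0.
rewrite (_ : [sequence _]_n = (fun n => (fps_poly A * U) n / U n * (U n / U n.+1) + c)); last first.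
  by apply/funext => n; exact: step.
rewrite !hornerE; apply: cvgD; last exact: cvg_cst.
by apply: cvgM => //; exact: renewal_ratio_cvg.
Qed.

End RenewalRatio.

(** * The ratio of letters *)

Definition disc (R : pzRingType) (r s : R) :=
  (1 - r) ^+ 2 + 4 * r * (1 - r) * s - 4 * r ^+ 2 * s ^+ 2.

(* With [r = rho], [s = S(rho)] and [t = k S(rho)], [lim_num] and [lim_den] are the limits of
   [4 [z^n]L / U_(n+1)] and [4 (n+1) [z^n]R / U_(n+1)], simplified by means of [Delta(rho) = 0],
   which reads [disc r s = 8 (k+1) r^2]. *)
Definition lim_num (R : unitRingType) (r s t : R) :=
  disc r s / 2 - 4 * r ^+ 2 - 2 * t * r * (1 - r - 2 * r * s).

Definition lim_den (R : unitRingType) (r s t : R) :=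
  r * (1 - r) - 2 * s * (r - 2 * r ^+ 2) - 4 * t * r * (1 - r) + 4 * r ^+ 2 * s ^+ 2
  + 8 * t * r ^+ 2 * s + disc r s.

Section LetterRatio.
Variables (R : realType) (k : nat).
Hypothesis k_ge2 : (2 <= k)%N.

Local Notation X := (fps_poly ('X : {poly R})).
Local Notation kf := (fps_poly (k%:R%:P : {poly R})).
Local Notation Rf := (gen (@na_fun R k)).
Local Notation Sf := (gen (@star_fun R k)).
Local Notation Lf := (gen (@letter_fun R k)).
Local Notation c := (num_stars R k).

Let Sp : {poly R} := c%:P * 'X^(k.*2).
Let Delta : {poly R} :=
  (1 - 'X) ^+ 2 + 4 * 'X * (1 - 'X) * Sp - 4 * 'X ^+ 2 * Sp ^+ 2
  - 8 * (1 + k%:R%:P) * 'X ^+ 2.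
Let h : fps R := X + 4 * X * Rf - 2 * X * Sf.
Let U := fps_inv (1 - h).

Lemma stars_poly : Sf = fps_poly Sp.
Proof. exact: star_gen_poly. Qed.

(** Completing the square: the equation for [R], quadratic with leading coefficient [2X], is
    multiplied by [8X]. *)
Lemma sqr_h : (1 - h) ^+ 2 = fps_poly Delta.
Proof.
have R0 : X * (1 + kf + Rf + (Rf - Sf) ^+ 2 + Rf ^+ 2) - Rf = 0.
  by apply/eqP; rewrite subr_eq0; apply/eqP/esym/na_gen_eq.
have -> : fps_poly Delta = (1 - X) ^+ 2 + 4 * X * (1 - X) * Sf - 4 * X ^+ 2 * Sf ^+ 2
    - 8 * (1 + kf) * X ^+ 2.
  by rewrite stars_poly /Delta; ring.
by rewrite -[RHS]addr0 -(mulr0 (8 * X)) -R0 /h; ring.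
Qed.

Lemma hX : h = X * (1 + fps_poly 4%:P * Rf - fps_poly 2%:P * Sf).
Proof. by rewrite /h !rmorph_nat; ring. Qed.

Lemma h_val0 : h 0%N = 0.
Proof. by rewrite hX fps_polyXM0. Qed.

Lemma h_succ n : h n.+1 = (n == 0%N)%:R + 4 * Rf n - 2 * Sf n.
Proof. by rewrite hX fps_polyXM fpsBE fpsDE fps1E !fps_polyCM. Qed.

Lemma h_succ_gt0 n : 0 < h n.+1.
Proof.
rewrite h_succ; case: n => [|n]; first by rewrite !gen0 !mulr0 addr0 subr0.
rewrite add0r; have := na_gen_gt0 R k n; have := star_gen_le_na R k n.+1.
by set r := gen _ _; set s := gen _ _; lra.
Qed.

Lemma h_inverse : (1 - h) * U = 1.
Proof. by rewrite fps_mulV // fpsBE fps1E h_val0 subr0. Qed.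

Let A : {poly R} := k%:R%:P * 'X - (k%:R / 2)%:P * Sp * (1 - 'X - 2 * 'X * Sp).

(** The equation for [L] is linear, with coefficient [1 - h] once collected. [R] is eliminated by
    [4XR = h - X + 2XS], and the summand [(k/2) S (1 - h)] that arises becomes the polynomial part
    after division. *)
Lemma letters_renewal : Lf = fps_poly A * U + fps_poly ((k%:R / 2)%:P * Sp).
Proof.
have L0 : Lf - X * (kf + Lf + 2 * (Lf - kf * Sf) * (Rf - Sf) + 2 * Lf * Rf) = 0.
  by apply/eqP; rewrite subr_eq0; apply/eqP/letter_gen_eq.
pose k2 := fps_poly ((k%:R / 2)%:P : {poly R}).
have kE : kf = 2 * k2.
  apply/fpsP => n; rewrite mulr_natl fpsMnE /= !coefC.
  by case: ifP => _; [field | rewrite mul0rn].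
have -> : fps_poly A = kf * X - k2 * Sf * (1 - X - 2 * X * Sf).
  by rewrite stars_poly /A /k2; ring.
have -> : fps_poly ((k%:R / 2)%:P * Sp) = k2 * Sf by rewrite stars_poly rmorphM.
transitivity (Lf * ((1 - h) * U)); first by rewrite h_inverse mulr1.
transitivity ((kf * X - k2 * Sf * (1 - X - 2 * X * Sf)) * U + k2 * Sf * ((1 - h) * U)
   + (Lf - X * (kf + Lf + 2 * (Lf - kf * Sf) * (Rf - Sf) + 2 * Lf * Rf)) * U).
  by rewrite kE /h; ring.
by rewrite L0 mul0r addr0 h_inverse mulr1.
Qed.

Let P : {poly R} := (- 2^-1)%:P * ('X * Delta^`()).

Lemma theta_h : fps_theta h = fps_poly P * U.
Proof.
have two : fps_poly (2^-1)%:P * 2 = 1 :> fps R.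
  rewrite mulr_natr; apply/fpsP => n; rewrite fpsMnE fps1E /= coefC.
  by case: n => [|n] /=; [lra | rewrite mul0rn].
have := neg_log_derivE sqr_h h_inverse; rewrite /neg_log_deriv fps_theta_poly => thetaE.
have -> : fps_poly P = - (fps_poly (2^-1)%:P * fps_poly ('X * Delta^`())).
  by rewrite /P polyCN mulNr rmorphN rmorphM.
move: (fps_poly ('X * Delta^`())) thetaE => d thetaE.
transitivity (fps_poly (2^-1)%:P * (2 * fps_theta h * ((1 - h) * U))).
  by rewrite h_inverse mulr1 mulrA two mul1r.
transitivity (fps_poly (2^-1)%:P * ((1 - h) * (2 * fps_theta h * U))); first by ring.
rewrite -thetaE.
transitivity (- fps_poly (2^-1)%:P * d * U * ((1 - h) * U)); first by ring.
by rewrite h_inverse; ring.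
Qed.

Lemma num_stars_ge0 : 0 <= c.
Proof. by apply: gen_ge0 => e; exact: ler0n. Qed.

(** The bound on [num_stars] is applied at [sqrt 2 * x], which yields the factor [2^k]; its
    hypothesis becomes [8kx^2 <= 1]. *)
Lemma sigma_le (x : R) : 0 <= x -> 8 * k.+1%:R * x ^+ 2 <= 1 ->
  c * x ^+ k.*2 * 2 ^+ k <= 1 / 2.
Proof.
move=> x_ge0 x_le.
have -> : c * x ^+ k.*2 * 2 ^+ k = c * (Num.sqrt 2 * x) ^+ k.*2.
  by rewrite exprMn -[in RHS]mul2n (exprM (Num.sqrt 2)) sqr_sqrtr // mul2n; ring.
apply: num_stars_le; rewrite ?mulr_ge0 ?sqrtr_ge0 //; first exact: ltnW.
rewrite exprMn sqr_sqrtr //; apply: le_trans x_le.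
rewrite [leRHS]mulrAC [leLHS](_ : _ = 8 * x ^+ 2 * k%:R); last by ring.
by rewrite ler_wpM2l ?mulr_ge0 ?sqr_ge0 // ler_nat.
Qed.

Lemma horner_Delta x : Delta.[x] = (1 - x) ^+ 2 + 4 * x * (1 - x) * (c * x ^+ k.*2)
  - 4 * x ^+ 2 * (c * x ^+ k.*2) ^+ 2 - 8 * k.+1%:R * x ^+ 2.
Proof.
have Spx : Sp.[x] = c * x ^+ k.*2 by rewrite /Sp !hornerE.
rewrite -Spx -natr1 /Delta.
by rewrite !(hornerD, hornerN, hornerM, horner_exp, hornerX, hornerC, hornerMn); ring.
Qed.

Lemma horner_theta_Delta x : ('X * Delta^`()).[x] =
  - 2 * x * (1 - x) + 4 * (c * x ^+ k.*2) * (x - 2 * x ^+ 2)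
  + 8 * k%:R * x * (1 - x) * (c * x ^+ k.*2) - 8 * x ^+ 2 * (c * x ^+ k.*2) ^+ 2
  - 16 * k%:R * x ^+ 2 * (c * x ^+ k.*2) ^+ 2 - 16 * k.+1%:R * x ^+ 2.
Proof.
have Spx : Sp.[x] = c * x ^+ k.*2 by rewrite /Sp !hornerE.
have dSpx : x * Sp^`().[x] = 2 * k%:R * (c * x ^+ k.*2).
  have monomE m : 'X * ('X^m)^`() = 'X^m *+ m :> {poly R}.
    by rewrite derivXn; case: m => [|m]; rewrite ?mulr0n ?mulr0 // mulrnAr -exprS.
  have -> : x * Sp^`().[x] = ('X * Sp^`()).[x] by rewrite hornerM hornerX.
  rewrite /Sp derivM derivC mul0r add0r mulrCA monomE hornerM hornerC hornerMn.
  by rewrite hornerXn -mul2n; ring.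
rewrite -Spx in dSpx *; rewrite /Delta; move: (Sp) dSpx => q dq.
rewrite !expr2 !(derivD, derivN, derivM, derivC, derivMn, derivX).
rewrite !(hornerD, hornerN, hornerM, hornerX, hornerC, hornerMn) -natr1.
apply/eqP; rewrite -subr_eq0; apply/eqP.
transitivity ((4 * x * (1 - x) - 8 * x ^+ 2 * q.[x]) * (x * q^`().[x] - 2 * k%:R * q.[x])).
  by ring.
by rewrite dq subrr mulr0.
Qed.

Lemma dominant_root : exists rho : R, [/\ 0 < rho, 8 * k.+1%:R * rho ^+ 2 <= 1,
  Delta.[rho] = 0 & forall x : R, 0 <= x < rho -> 0 < Delta.[x]].
Proof.
(* Chosen so that [8 (k+1) b^2 = 1]: with [s = S(b) <= 1/8], a bound that rests on [2^k >= 4], one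
   gets [Delta(b) <= -2b + b^2 + 4b(1 - b)s < 0]. *)
pose b : R := (Num.sqrt (8 * k.+1%:R))^-1.
have k8_gt0 : 0 < 8 * k.+1%:R :> R by rewrite mulr_gt0.
have b_gt0 : 0 < b by rewrite invr_gt0 sqrtr_gt0.
have b_sqr : 8 * k.+1%:R * b ^+ 2 = 1.
  by rewrite exprVn sqr_sqrtr ?ltW // divff // gt_eqF.
have k_ge : 2 <= k%:R :> R by rewrite ler_nat.
have b_lt1 : b < 1.
  rewrite -(@ltr_pXn2r _ 2) ?nnegrE ?ltW // expr1n.
  by have := sqr_ge0 b; move: b_sqr; rewrite -natr1; nra.
have sigma_ge0 : 0 <= c * b ^+ k.*2 by rewrite mulr_ge0 ?num_stars_ge0 ?exprn_ge0 // ltW.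
have sigma_small : c * b ^+ k.*2 <= 1 / 8.
  have := @sigma_le b (ltW b_gt0); rewrite b_sqr lexx => /(_ isT).
  have : 4 <= 2 ^+ k :> R.
    rewrite -natrX ler_nat (_ : 4 = 2 ^ 2)%N //.
    by rewrite leq_exp2l.
  by move: sigma_ge0; set s := c * _; set t := 2 ^+ k; nra.
have [|||rho [rho_gt0 rho_le Drho Dpos]] := @first_root _ Delta b.
- exact: ltW.
- by rewrite (Delta0 h_val0 sqr_h).
- rewrite horner_Delta b_sqr; set s := c * _ in sigma_ge0 sigma_small *.
  by nra.
exists rho; split=> //; rewrite -[leRHS]b_sqr ler_wpM2l ?(ltW k8_gt0) //.
by rewrite lerXn2r // nnegrE ltW.
Qed.

(** For [n > 2k] one has [[z^n]L = (A U)_n] and [4 (n+1) [z^n]R = (n+1) h_(n+1) = (P U)_(n+1)], so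
    both are governed by [U]. The quotient tends to [4 rho A(rho) / P(rho)], which [Delta(rho) = 0]
    rewrites as [lim_num / lim_den]. *)
Lemma letters_ratio_cvg : exists rho sigma : R,
  [/\ 0 < rho, 8 * k.+1%:R * rho ^+ 2 <= 1, 0 <= sigma, sigma * 2 ^+ k <= 1 / 2 &
    (fun n => Lf n / (n%:R * Rf n)) @ \oo -->
      lim_num rho sigma (k%:R * sigma) / lim_den rho sigma (k%:R * sigma)].
Proof.
have [rho [rho_gt0 rho_le Drho Dpos]] := dominant_root.
have deriv_lt0 : Delta^`().[rho] < 0 by exact: (Delta_deriv_lt0 h_val0 h_succ_gt0 sqr_h).
have P_gt0 : 0 < P.[rho].
  rewrite /P hornerM hornerC hornerM hornerX mulNr -mulrN -mulrN.
  by rewrite !mulr_gt0 ?invr_gt0 // oppr_gt0.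
pose sigma := c * rho ^+ k.*2.
exists rho, sigma; split => //.
- by rewrite mulr_ge0 ?num_stars_ge0 ?exprn_ge0 // ltW.
- exact: sigma_le (ltW rho_gt0) rho_le.
have discE : 8 * k.+1%:R * rho ^+ 2 = disc rho sigma.
  by apply/eqP; rewrite eq_sym -subr_eq0 -Drho horner_Delta.
have numE : lim_num rho sigma (k%:R * sigma) = 4 * (A.[rho] * rho).
  have Spx : Sp.[rho] = sigma by rewrite /Sp !hornerE.
  rewrite /lim_num -discE -natr1 /A; move: (Sp) Spx => q Spx.
  rewrite !(hornerD, hornerN, hornerM, hornerX, hornerC, hornerMn) Spx.
  by field.
have denE : lim_den rho sigma (k%:R * sigma) = P.[rho].
  rewrite /P hornerM hornerC horner_theta_Delta -/sigma /lim_den -discE.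
  by field.
rewrite numE denE.
have AU : (fun n => (fps_poly A * U) n / U n) @ \oo --> A.[rho].
  apply: (poly_mul_renewal_cvg h_val0 h_succ_gt0 sqr_h rho_gt0 Drho Dpos h_inverse).
have PU : (fun n => (fps_poly P * U) n / U n) @ \oo --> P.[rho].
  apply: (poly_mul_renewal_cvg h_val0 h_succ_gt0 sqr_h rho_gt0 Drho Dpos h_inverse).
have UU : (fun n => U n / U n.+1) @ \oo --> rho.
  apply: (renewal_ratio_cvg h_val0 h_succ_gt0 sqr_h rho_gt0 Drho Dpos h_inverse).
have Upos := renewal_gt0 h_val0 h_succ_gt0 h_inverse.
rewrite -cvg_shiftS in PU.
pose num n := 4 * ((fps_poly A * U) n / U n * (U n / U n.+1)).
(* The factor [1 - 1/(n+1)] replaces the [n+1] produced by [theta] by the [n] of the ratio. *)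
pose den n := (fps_poly P * U) n.+1 / U n.+1 * (1 - n.+1%:R^-1).
have cvg_quot : (fun n => num n / den n) @ \oo --> 4 * (A.[rho] * rho) / P.[rho].
  apply: cvgM; first by apply: cvgM; [exact: cvg_cst | exact: cvgM].
  apply: cvgV; first by rewrite gt_eqF.
  rewrite -[X in _ --> X]mulr1; apply: cvgM; first exact: PU.
  rewrite -[X in _ --> X]subr0; apply: cvgB; first exact: cvg_cst.
  exact: cvg_harmonic.
apply: cvg_trans cvg_quot; apply: near_eq_cvg; near=> n.
have n_large : (k.*2 < n)%N by near: n; exists (k.*2).+1.
have Sn : Sf n = 0.
  by rewrite stars_poly /= coefCM coefXn gtn_eqF // mulr0.
have -> : Lf n = (fps_poly A * U) n.
  rewrite letters_renewal fpsDE [X in _ + X = _]/= coefCM.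
  by rewrite -[Sp`_n]/(fps_poly Sp n) -stars_poly Sn mulr0 addr0.
have n_gt0 : 0 < n%:R :> R by rewrite ltr0n; lia.
have Rn : 4 * Rf n = h n.+1.
  by rewrite h_succ Sn mulr0 subr0; case: (n) n_large => // m _; rewrite add0r.
have PUn : (fps_poly P * U) n.+1 = h n.+1 * n.+1%:R by rewrite -theta_h mulr_natr.
rewrite /num /den PUn -Rn.
have Rpos : 0 < Rf n by case: (n) n_large => // m _; exact: na_gen_gt0.
have Un := Upos n; have Un1 := Upos n.+1.
move: (Rf n) (U n) (U n.+1) ((fps_poly A * U) n) Rpos Un Un1 => r u u1 a r_gt0 u_gt0 u1_gt0.
rewrite -[n.+1%:R]natr1; have n1_gt0 : 0 < n%:R + 1 :> R by rewrite addr_gt0.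
have -> : 1 - (n%:R + 1)^-1 = n%:R / (n%:R + 1) :> R by field; rewrite gt_eqF.
by field; rewrite !gt_eqF.
Unshelve. all: by end_near.
Qed.

End LetterRatio.

(** * The limit for large alphabets *)

Lemma mulnn_le_exp2 n : (n.+1 * n.+2 <= 2 * 2 ^ n.+2)%N.
Proof.
elim: n => // n IH; rewrite expnS.
by case: n IH => // n IH; nia.
Qed.

(** [rho], [sigma] and [(k+2) sigma] tend to 0, and at the origin the numerator is [1/2] and the
    denominator 1. The index [k] stands for an alphabet of size [k+2]. *)
Lemma lim_quot_cvg (R : realType) (rho sigma : nat -> R) :
    (forall k, [/\ 0 < rho k, 8 * k.+3%:R * rho k ^+ 2 <= 1, 0 <= sigma k
      & sigma k * 2 ^+ k.+2 <= 1 / 2]) ->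
  (fun k => lim_num (rho k) (sigma k) (k.+2%:R * sigma k)
          / lim_den (rho k) (sigma k) (k.+2%:R * sigma k)) @ \oo --> (1 / 2 : R).
Proof.
move=> H; pose tau k := k.+2%:R * sigma k.
have rho_gt0 k : 0 < rho k by have [] := H k.
have sigma_ge0 k : 0 <= sigma k by have [] := H k.
have rho2 k : rho k ^+ 2 <= harmonic k.
  have [_ rho_le _ _] := H k.
  rewrite /harmonic /= -[leRHS]mul1r ler_pdivlMr ?ltr0n //.
  apply: le_trans rho_le; rewrite mulrC ler_wpM2r ?sqr_ge0 //.
  by rewrite -natrM ler_nat; lia.
(* The decay [2^(-k)] of [sigma] absorbs the factor [k+2] and still leaves [1/(k+1)]. *)
have tau_le k : tau k <= harmonic k.
  have [_ _ _ sigma_le] := H k.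
  rewrite /harmonic /= -[leRHS]mul1r ler_pdivlMr ?ltr0n //.
  have -> : tau k * k.+1%:R = sigma k * (k.+1 * k.+2)%:R by rewrite natrM /tau; ring.
  apply: (@le_trans _ _ (sigma k * (2 * 2 ^ k.+2)%:R)).
    by rewrite ler_wpM2l // ler_nat mulnn_le_exp2.
  by move: sigma_le; rewrite natrM natrX; lra.
have sigma_le k : sigma k <= tau k by rewrite /tau ler_peMl // ler1n.
have tau0 : tau @ \oo --> (0 : R).
  apply: (@squeeze_cvgr _ _ _ _ (fun=> 0) (@harmonic R)).
  - by near=> k; rewrite tau_le mulr_ge0.
  - exact: cvg_cst.
  - exact: cvg_harmonic.
have sigma0 : sigma @ \oo --> (0 : R).
  apply: (@squeeze_cvgr _ _ _ _ (fun=> 0) tau) => //.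
  - by near=> k; rewrite sigma_ge0 sigma_le.
  - exact: cvg_cst.
have rho0 : rho @ \oo --> (0 : R).
  apply/cvgr0Pnorm_lt => e e_gt0.
  have e2_gt0 : 0 < e ^+ 2 by rewrite exprn_gt0.
  have /cvgr0Pnorm_lt /(_ _ e2_gt0) [N _ HN] := @cvg_harmonic R.
  exists N => // k Nk; have := HN k Nk; rewrite /= !gtr0_norm ?invr_gt0 ?ltr0n //.
  move=> lt_e2; rewrite -(@ltr_pXn2r _ 2) ?nnegrE ?ltW //.
  exact: le_lt_trans (rho2 k) lt_e2.
have disc1 : (fun k => disc (rho k) (sigma k)) @ \oo --> disc (0 : R) 0.
  rewrite /disc !expr2.
  by do ![exact: cvg_cst | exact: rho0 | exact: sigma0 | apply: cvgM | apply: cvgB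
         | apply: cvgD].
have num0 : (fun k => lim_num (rho k) (sigma k) (tau k)) @ \oo --> lim_num (0 : R) 0 0.
  rewrite /lim_num !expr2.
  by do ![exact: cvg_cst | exact: rho0 | exact: sigma0 | exact: tau0 | exact: disc1
         | apply: cvgM | apply: cvgB | apply: cvgD].
have den0 : (fun k => lim_den (rho k) (sigma k) (tau k)) @ \oo --> lim_den (0 : R) 0 0.
  rewrite /lim_den !expr2.
  by do ![exact: cvg_cst | exact: rho0 | exact: sigma0 | exact: tau0 | exact: disc1
         | apply: cvgM | apply: cvgB | apply: cvgD].
have den1 : lim_den (0 : R) 0 0 = 1 by rewrite /lim_den /disc; ring.
have -> : 1 / 2 = lim_num (0 : R) 0 0 / lim_den (0 : R) 0 0.
  by rewrite den1 /lim_num /disc; field.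
apply: cvgM; first exact: num0.
by apply: cvgV => //; rewrite den1 oner_neq0.
Unshelve. all: by end_near.
Qed.

(** * Transfer to the counting functions and to convergence in the Stdlib reals *)

Lemma gen_coefR (R : realFieldType) k n : gen (@na_fun R k) n = (coefR k n)%:R.
Proof.
rewrite /coefR -sum1_count natr_sum [RHS]big_mkcond /=.
by apply: eq_bigr => e _; rewrite /na_fun; case: (re_na e).
Qed.

Lemma gen_coefL (R : realFieldType) k n : gen (@letter_fun R k) n = (coefL k n)%:R.
Proof.
rewrite /coefL sumnE big_map big_filter natr_sum [RHS]big_mkcond /=.
apply: eq_bigr => e _; rewrite /letter_fun /na_fun.
by case: (re_na e); rewrite ?mulr1 ?mulr0.
Qed.

Lemma letter_ratioE k n : letter_ratio k n =
  gen (@letter_fun Rdefinitions.R k) n / (n%:R * gen (@na_fun Rdefinitions.R k) n).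
Proof. by rewrite gen_coefR gen_coefL /letter_ratio !INRE. Qed.

Lemma cvg_eps (R : realType) (u : nat -> R) (l : R) : u @ \oo --> l ->
  forall eps, 0 < eps -> exists N, forall n, (N <= n)%N -> `|u n - l| < eps.
Proof.
move=> /cvgrPdist_lt u_l eps eps_gt0; have [N _ HN] := u_l _ eps_gt0.
by exists N => n Nn; rewrite distrC; exact: HN.
Qed.

Lemma cvg_Un_cv (u : nat -> Rdefinitions.R) (l : Rdefinitions.R) :
  u @ \oo --> l -> Rseries.Un_cv u l.
Proof.
move=> /cvg_eps u_l eps /RltP eps_gt0.
have [N HN] := u_l _ eps_gt0; exists N => n /ssrnat.leP Nn.
by apply/RltP; rewrite RdistE; exact: HN.
Qed.

Lemma letter_ratio_limits : exists ell : nat -> Rdefinitions.R,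
  (forall k, (2 <= k)%N -> Rseries.Un_cv (letter_ratio k) (ell k)) /\
  Rseries.Un_cv ell (1 / 2 : Rdefinitions.R).
Proof.
have rsP k : exists rs : Rdefinitions.R * Rdefinitions.R,
    let: (r, s) := rs in [/\ 0 < r, 8 * k.+3%:R * r ^+ 2 <= 1, 0 <= s,
      s * 2 ^+ k.+2 <= 1 / 2 &
      letter_ratio k.+2 @ \oo -->
        (lim_num r s (k.+2%:R * s) / lim_den r s (k.+2%:R * s) : Rdefinitions.R)].
  have [r [s [r_gt0 r_le s_ge0 s_le ratio_cvg]]] :=
    @letters_ratio_cvg Rdefinitions.R k.+2 isT.
  exists (r, s); split => //.
  by rewrite (funext (letter_ratioE k.+2)).
have [rs rs_spec] := choice rsP.
pose rho k := (rs k).1; pose sigma k := (rs k).2.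
pose ell k := lim_num (rho k) (sigma k) (k.+2%:R * sigma k)
  / lim_den (rho k) (sigma k) (k.+2%:R * sigma k).
(* The local [ell] is indexed by the alphabet size minus 2; truncated subtraction gives sizes 0 and
   1 the value for size 2. *)
exists (fun k => ell (k - 2)%N); split => [[|[|k]] // _|].
  apply: cvg_Un_cv; rewrite !subSS subn0 /ell /rho /sigma.
  by have := rs_spec k; case: (rs k) => r s /= [].
apply: cvg_Un_cv; rewrite -(cvg_shiftn 2).
rewrite (_ : [sequence _]_n = ell); last by apply/funext => k; rewrite /= addnK.
apply: lim_quot_cvg => k.
by have := rs_spec k; rewrite /rho /sigma; case: (rs k) => r s /= [].
Qed.

From mathcomp Require Import all_boot.
From Stdlib Require Import Reals.
Local Close Scope ring_scope.
Local Close Scope classical_set_scope.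

Theorem theorem6 :
  exists ell : nat -> R,
    (forall k : nat, (2 <= k)%N -> Un_cv (letter_ratio k) (ell k)) /\
    Un_cv ell (1 / 2)%R.
Proof.
have [ell [ratio_cvg ell_cvg]] := letter_ratio_limits.
exists ell; split => //.
Qed.
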